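(* For every fixed $\varepsilon>0$ and every fixed integer $m\ge 2$, we have $\mathfrak{s}(\mathbb{Z}_m^n)\le D_{\varepsilon,m}\cdot (C_\varepsilon m^{\varepsilon})^n$ for all positive integers $n$. Here, $C_\varepsilon$ is a constant only depending on $\varepsilon$, and $D_{\varepsilon,m}$ is a constant only depending on $\varepsilon$ and $m$.
   Context: For positive integers $m,n$, the Erdős–Ginzburg–Ziv constant $\mathfrak{s}(\mathbb{Z}_m^n)$ is the smallest integer $s$ such that every sequence of $s$ elements of $\mathbb{Z}_m^n$ contains a subsequence of length $m$ whose sum is zero. Equivalently, it is the smallest $s$ such that among any $s$ points of the integer lattice $\mathbb{Z}^n$ one can find $m$ points whose centroid is again a lattice point. *)

(* Defs.v *)
From HB Require Import structures.
From mathcomp Require Import all_boot all_order all_algebra.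
Set Implicit Arguments.
Unset Strict Implicit.
Unset Printing Implicit Defensive.
Import GRing.Theory.
Local Open Scope ring_scope.

(* The additive group of 'I_k.+1 is the cyclic group of order k.+1, so this is
   the group of integers modulo m for every m > 0, including m = 1, where 'Z_1
   would have two elements. At m = 0 it is a trivial group. *)
Definition Zm (m : nat) : finZmodType := 'I_m.-1.+1.

Definition Zmn (m n : nat) : finZmodType := 'rV[Zm m]_n.

Definition has_zero_sum_subseq (m n : nat) (u : seq (Zmn m n)) : bool :=
  [exists t : m.-tuple (Zmn m n), subseq t u && (\sum_(x <- t) x == 0)].

Definition egz_property (m n s : nat) : bool :=
  [forall u : s.-tuple (Zmn m n), has_zero_sum_subseq u].

Lemma Zmn_exponent (m n : nat) (x : Zmn m n) : x *+ m = 0.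
Proof.
case: m x => [|m] x; first by rewrite mulr0n.
apply/matrixP => i j; rewrite mulmxnE mxE.
by rewrite Zp_mulrn; apply: val_inj; rewrite /= modnMl.
Qed.

Lemma frequent_element (T : finType) (x0 : T) (m : nat) (u : seq T) :
  (m * #|T| <= size u)%N -> exists x : T, (m <= count_mem x u)%N.
Proof.
move=> le_mu; apply/existsP; apply: contraT; rewrite negb_exists => /forallP H.
have lt_m x : (count_mem x u < m)%N by rewrite ltnNge H.
have size_u : (\sum_(x : T) count_mem x u = size u)%N.
  rewrite -sum1_size (eq_bigr (fun x => \sum_(y <- u) (x == y))%N).
    rewrite exchange_big; apply: eq_bigr => y _ /=.
    by rewrite (bigD1 y) //= eqxx big1 // => z /negbTE ->.
  move=> x _; rewrite -sum1_count big_mkcond /=.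
  by apply: eq_bigr => y _; rewrite eq_sym; case: eqP.
suff : (\sum_(x : T) count_mem x u < \sum_(x : T) m)%N.
  by rewrite size_u sum_nat_const mulnC ltnNge le_mu.
rewrite (bigD1 x0) //= [ltnRHS](bigD1 x0) //= -addSn.
by apply: leq_add => //; apply: leq_sum => x _; apply: ltnW.
Qed.

Lemma egz_exists (m n : nat) : exists s, egz_property m n s.
Proof.
exists (m * #|Zmn m n|)%N; apply/forallP => u.
have [x mx] := frequent_element (0 : Zmn m n) (eq_leq (esym (size_tuple u))).
apply/existsP; exists (nseq_tuple m x); apply/andP; split.
  apply: (@subseq_trans _ (filter (pred1 x) u)); last exact: filter_subseq.
  have -> : filter (pred1 x) u = nseq (count_mem x u) x.
    by rewrite -size_filter; apply/all_pred1P; exact: filter_all.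
  by rewrite -(subnKC mx) nseqD; exact: prefix_subseq.
by rewrite big_nseq iter_addr_0 Zmn_exponent.
Qed.

Definition egz (m n : nat) : nat := ex_minn (egz_exists m n).

(* Main.v *)
Require Import Defs.
From HB Require Import structures.
From mathcomp Require Import all_boot all_order all_algebra.
From mathcomp Require Import finfield.
From mathcomp Require Import reals exp.
From mathcomp Require Import zify boolp ring.
Set Implicit Arguments.
Unset Strict Implicit.
Unset Printing Implicit Defensive.
Import Order.TTheory GRing.Theory Num.Theory.
Local Open Scope ring_scope.

(* Since s(Z_ab^n) <= a s(Z_b^n) + s(Z_a^n), it suffices to treat large primes p
   and a set A in G = F_p^n with |A| >= p^(eps n).

   Zero-sum p-tuples over a set A' start with the constant ones.  Given many
   disjoint zero-sum tuples with the same pattern of equalities, the slice rank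
   method finds a zero-sum tuple mixing them and having more distinct entries,
   as long as a fraction 1/h of the positions carries repeated entries; this
   only needs |A'| >= C(h)^n.  So there is a zero-sum tuple over A' in which all
   but p/h of the entries are distinct.

   It remains to replace each repeated entry a, together with boundedly many of
   the distinct entries, by distinct elements of A with the same sum.  This is
   possible if these sums are robust, meaning that they can still be represented
   after deleting any p elements of A.  Replacing A by a dense subset we may
   assume that sums B_1 + .. + B_k of dense subsets of A are nearly as large as
   (2k + 1) A.  If A' is a random sparse subset of A, every large enough subset
   of A' contains a set whose sum t is such that t - z is robust for a dense set
   of z in A, and a + t_1 + .. + t_2k is robust for any 2k such sums t_i. *)

(** * Sumsets *)

Section Sumset.
Variable G : finZmodType.
Implicit Types X Y Z B C : {set G}.

Definition sumset X Y : {set G} := [set x + y | x in X, y in Y].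

Lemma sumsetP X Y z :
  reflect (exists2 x, x \in X & exists2 y, y \in Y & z = x + y)
          (z \in sumset X Y).
Proof.
apply: (iffP imset2P) => [[x y xX yY ->]|[x xX [y yY ->]]].
  by exists x => //; exists y.
by exists x y.
Qed.

Lemma mem_sumset X Y x y : x \in X -> y \in Y -> x + y \in sumset X Y.
Proof. by move=> xX yY; apply/sumsetP; exists x => //; exists y. Qed.

Lemma sumsetS X X' Y Y' :
  X \subset X' -> Y \subset Y' -> sumset X Y \subset sumset X' Y'.
Proof. exact: imset2S. Qed.

Lemma sumsetA X Y Z : sumset X (sumset Y Z) = sumset (sumset X Y) Z.
Proof.
apply/setP => u; apply/sumsetP/sumsetP.
  case=> x xX [_ /sumsetP[y yY [z zZ ->]] ->].
  by exists (x + y); rewrite ?mem_sumset //; exists z; rewrite ?addrA.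
case=> _ /sumsetP[x xX [y yY ->]] [z zZ ->].
by exists x => //; exists (y + z); rewrite ?mem_sumset ?addrA.
Qed.

Lemma sumsetC X Y : sumset X Y = sumset Y X.
Proof.
by apply/setP => u; apply/sumsetP/sumsetP => -[x xX [y yY ->]];
  exists y => //; exists x => //; rewrite addrC.
Qed.

Lemma card_sumset_translate X c : #|sumset [set c] X| = #|X|.
Proof. by rewrite /sumset imset2_set1l card_imset //; exact: addrI. Qed.

Lemma leq_card_sumset X Y : Y != set0 -> (#|X| <= #|sumset X Y|)%N.
Proof.
case/set0Pn => y yY; rewrite sumsetC -(card_sumset_translate X y).
by apply/subset_leq_card/sumsetS; rewrite // sub1set.
Qed.

Fixpoint msum (B : nat -> {set G}) (k : nat) : {set G} :=
  if k is k'.+1 then sumset (msum B k') (B k') else [set 0].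

Lemma mem_msum (B : nat -> {set G}) k (z : nat -> G) :
  (forall i, (i < k)%N -> z i \in B i) -> \sum_(i < k) z i \in msum B k.
Proof.
elim: k => [|k IHk] zB /=; first by rewrite big_ord0 set11.
by rewrite big_ord_recr mem_sumset ?zB // IHk // => i /ltnW; apply: zB.
Qed.

Lemma msumP (B : nat -> {set G}) k s : s \in msum B k ->
  exists2 z : nat -> G,
    (forall i, (i < k)%N -> z i \in B i) & s = \sum_(i < k) z i.
Proof.
elim: k s => [|k IHk] s /=.
  by move/set1P->; exists (fun=> 0); rewrite ?big_ord0.
case/sumsetP => x /IHk[z zB ->] [y yB ->].
exists (fun i => if i == k then y else z i) => [i|].
  by rewrite ltnS leq_eqVlt => /orP[/eqP->|ltik]; rewrite ?eqxx // ltn_eqF ?zB.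
rewrite big_ord_recr /= eqxx; congr (_ + _).
by apply: eq_bigr => i _; rewrite ltn_eqF.
Qed.

Lemma leq_card_msum (B : nat -> {set G}) j d :
  (forall i, (i < j + d)%N -> B i != set0) ->
  (#|msum B j| <= #|msum B (j + d)|)%N.
Proof.
elim: d => [|d IHd] B0; first by rewrite addn0.
rewrite addnS in B0 *; apply: leq_trans (IHd _) _ => [i /ltnW|];
  first exact: B0.
by apply: leq_card_sumset; apply: B0.
Qed.

Lemma card_msum_gt0 (B : nat -> {set G}) k : (forall i, (i < k)%N ->
  B i != set0) ->
  (0 < #|msum B k|)%N.
Proof.
move=> B0; rewrite -[k]add0n; apply: leq_trans (leq_card_msum (j := 0) _) => //.
by rewrite /= cards1.
Qed.

(** Induction on C = c |: D. Let X' be the set of x in X with c + x already in D + X. Adding c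
    enlarges D + X by |X| - |X'| and D + X + B by at most |X + B| - |X' + B|; minimality of X
    compares the two gains. *)
Lemma petridis X B C :
  (forall X', X' \subset X ->
     (#|sumset X B| * #|X'| <= #|sumset X' B| * #|X|)%N) ->
  (#|sumset (sumset C X) B| * #|X| <= #|sumset X B| * #|sumset C X|)%N.
Proof.
move=> minX; have [m] := ubnP #|C|; elim: m => // m IHm in C *.
case: (set_0Vmem C) => [-> _|[c cC]].
  have s0 Y : sumset set0 Y = set0.
    by apply/setP => x; rewrite inE; apply/sumsetP => -[y]; rewrite inE.
  by rewrite !s0 cards0 muln0.
rewrite (cardsD1 c) cC => /IHm{IHm}; set D := C :\ c => IH.
pose X' := [set x in X | c + x \in sumset D X].
have sX'X : X' \subset X by apply/subsetP => x; rewrite inE => /andP[].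
have CE : C = c |: D by rewrite setD1K.
have sumU Y : sumset C Y = sumset [set c] Y :|: sumset D Y.
  apply/setP => u; rewrite inE; apply/sumsetP/orP.
    case=> x; rewrite CE => /setU1P[->|xD] [y yY ->].
      by left; rewrite mem_sumset ?set11.
    by right; rewrite mem_sumset.
  case=> /sumsetP[x xc [y yY ->]]; exists x; try by exists y.
    by rewrite CE (set1P xc) setU11.
  by rewrite CE setU1r.
pose cX := sumset [set c] X; pose cX' := sumset [set c] X'.
have card_CX : (#|sumset C X| + #|X'| = #|sumset D X| + #|X|)%N.
  rewrite sumU -(card_sumset_translate X c) -/cX.
  have -> : #|X'| = #|cX :&: sumset D X|.
    rewrite -(card_sumset_translate X' c); congr #|pred_of_set _|.
    apply/setP => u; rewrite inE; apply/sumsetP/andP.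
      case=> _ /set1P-> [x]; rewrite inE => /andP[xX cxDX] ->.
      by rewrite mem_sumset ?set11.
    case=> /sumsetP[_ /set1P-> [x xX ->]] cxDX.
    by exists c; rewrite ?set11 //; exists x; rewrite // inE xX.
  by rewrite cardsUI addnC.
have card_CXB : (#|sumset (sumset C X) B| + #|sumset X' B|
                 <= #|sumset (sumset D X) B| + #|sumset X B|)%N.
  rewrite -!sumsetA sumU -(card_sumset_translate (sumset X B) c).
  rewrite -(card_sumset_translate (sumset X' B) c).
  set P := sumset [set c] _; set Q := sumset D _; set P' := sumset [set c] _.
  apply: leq_trans (_ : #|P :|: Q| + #|P :&: Q| <= _)%N.
    rewrite leq_add2l subset_leq_card // subsetI; apply/andP; split.
      by apply/sumsetS => //; apply: sumsetS.
    rewrite /P' /Q !sumsetA; apply: sumsetS => //; apply/subsetP => u.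
    by case/sumsetP => _ /set1P-> [x]; rewrite inE => /andP[_ cxDX] ->.
  by rewrite cardsUI addnC.
have := minX _ sX'X.
move: card_CX card_CXB IH.
set a1 := #|sumset C X|; set a2 := #|sumset D X|.
set b1 := #|sumset (sumset C X) B|; set b2 := #|sumset (sumset D X) B|.
nia.
Qed.

(* Petridis' proof of Plunnecke's inequality: [X] minimizes |X + B| / |X| among
   the nonempty subsets of [Y]. *)
Lemma plunnecke Y B h : Y != set0 ->
  exists2 X : {set G}, (0 < #|X|)%N /\ X \subset Y &
  (#|msum (fun=> B) h| * #|Y| ^ h <= #|sumset Y B| ^ h * #|X|)%N.
Proof.
move=> Y0.
pose P X := (X != set0) && (X \subset Y).
have PY : P Y by rewrite /P Y0 /=.
pose r X : rat := #|sumset X B|%:R / #|X|%:R.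
have [X /andP[X0 sXY] minX] := @Order.TotalTheory.arg_minP _ _ _ Y P r PY.
have Xgt0 : (0 < #|X|)%N by rewrite card_gt0.
have minX' X' : X' \subset Y ->
    (#|sumset X B| * #|X'| <= #|sumset X' B| * #|X|)%N.
  have [->|X'0] := eqVneq X' set0; first by rewrite cards0 muln0.
  move=> sX'Y; have := minX X'; rewrite /P X'0 sX'Y => /(_ isT).
  rewrite /r ler_pdivlMr ?ltr0n ?card_gt0 // mulrAC ler_pdivrMr ?ltr0n //.
  by rewrite -!natrM ler_nat.
exists X => //.
have XhB : (#|sumset (msum (fun=> B) h) X| * #|X| ^ h
            <= #|sumset X B| ^ h * #|X|)%N.
  elim: h => [|h IHh].
    by rewrite card_sumset_translate !expn0 muln1 mul1n.
  have := @petridis X B (msum (fun=> B) h) _.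
  move=> /(_ (fun X' sX' => minX' X' (subset_trans sX' sXY))).
  rewrite -[sumset (sumset _ X) B]sumsetA [sumset X B]sumsetC sumsetA.
  rewrite -[sumset (msum _ h) B]/(msum (fun=> B) h.+1) ![sumset B X]sumsetC.
  move=> le1; rewrite !expnS mulnA.
  apply: leq_trans (leq_mul le1 (leqnn _)) _.
  by rewrite -!mulnA leq_mul2l IHh orbT.
(* The ratio |X + B| / |X| is at most |Y + B| / |Y|, which replaces X by Y in the h-th powers. *)
have := minX' Y (subxx _) => le2.
have X0h : (0 < #|X| ^ h)%N by rewrite expn_gt0 Xgt0.
rewrite -(leq_pmul2l X0h) mulnCA mulnA.
apply: (@leq_trans (#|sumset (msum (fun=> B) h) X| * #|X| ^ h * #|Y| ^ h)).
  rewrite leq_mul2r leq_mul2r leq_card_sumset //; lia.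
apply: (leq_trans (leq_mul XhB (leqnn _))).
rewrite mulnAC -expnMn mulnA -expnMn leq_mul2r [(#|X| * _)%N]mulnC.
by apply/orP; right; case: h {XhB X0h} => // h; rewrite leq_exp2r.
Qed.

End Sumset.

(** * Dense subsets with large sumsets *)

Section Regularity.
Variable G : finZmodType.
Implicit Types A X : {set G}.

(** Absorption adds one element to two blocks of k sets; all these sums of 2k + 1 elements are
    compared with a single block. *)
Definition spreading A (D c k : nat) :=
  forall B : nat -> {set G},
    (forall i, (i < k)%N -> B i \subset A /\ (#|A| <= D * #|B i|)%N) ->
    (#|msum (fun=> A) (k.*2).+1| <= c * #|msum B k|)%N.

(* Among the first hE + 1 partial sums of the [B i], which all have size at most
   beta ^ E, one grows by a factor at most beta ^ (1/h) when the next [B j] is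
   added; Plunnecke's inequality then bounds h [B j]. *)
Lemma small_multiple (B : nat -> {set G}) (beta E h : nat) :
  (1 < beta)%N -> (#|G| <= beta ^ E)%N ->
  (forall i, (i < (h * E).+1)%N -> B i != set0) ->
  exists2 j, (j < (h * E).+1)%N &
    (#|msum (fun=> B j) h| <= beta * #|msum B (h * E).+1|)%N.
Proof.
move=> beta_gt1 leG B0; set k := (h * E).+1.
have beta_gt0 : (0 < beta)%N by lia.
case: (boolP [exists j : 'I_k,
  #|msum B j.+1| ^ h <= beta * #|msum B j| ^ h]%N) => [/existsP[j le_j]|].
  have B0' i : (i < j)%N -> B i != set0.
    by move=> ltij; apply: B0; apply: ltn_trans ltij (ltn_ord j).
  have Y0 : msum B j != set0 by rewrite -card_gt0 card_msum_gt0.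
  exists (nat_of_ord j) => //.
  have [X [X0 sXY] leX] := plunnecke (B j) h Y0.
  have Yh : (0 < #|msum B j| ^ h)%N by rewrite expn_gt0 card_msum_gt0.
  have leXY := subset_leq_card sXY.
  have leYk : (#|msum B j| <= #|msum B k|)%N.
    have := @leq_card_msum G B j (k - j); rewrite subnKC; last exact: ltnW.
    by apply=> i; apply: B0.
  have : (#|msum (fun=> B j) h| * #|msum B j| ^ h
          <= beta * #|X| * #|msum B j| ^ h)%N.
    apply: leq_trans leX _; rewrite mulnAC leq_mul2r.
    by apply/orP; right; apply: le_j.
  rewrite leq_pmul2r // => /leq_trans; apply; rewrite leq_mul2l.
  by rewrite (leq_trans leXY leYk) orbT.
(* If every step grew by more than beta^(1/h), the h-th power of the last sum would reach beta^(hE +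
   1), exceeding |G|^h. *)
rewrite negb_exists => /forallP nle.
have le_pow j : (j <= k)%N -> (beta ^ j <= #|msum B j| ^ h)%N.
  elim: j => [|j IHj] ltjk; first by rewrite /= cards1 exp1n.
  have := nle (Ordinal ltjk); rewrite -ltnNge => /ltnW; apply: leq_trans.
  by rewrite expnS leq_mul2l IHj ?orbT // ltnW.
have := le_pow k (leqnn k); have := max_card (mem (msum B k)) => le1 le2.
have: (#|msum B k| ^ h <= beta ^ (h * E))%N.
  rewrite mulnC expnM; have [h0|h_gt0] := posnP h.
    by move: (k) => k'; rewrite h0 !expn0.
  by rewrite leq_exp2r // (leq_trans le1 leG).
move/(leq_trans le2); rewrite leq_exp2l //; lia.
Qed.

(** With h the value at level i, level i + 1 is 2k + 1 for the k = hE + 1 sets that [small_multiple]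
    takes. *)
Fixpoint scale (E i : nat) : nat :=
  if i is i'.+1 then (((scale E i' * E).+1).*2).+1 else 1.

(* If [spreading] fails for [A] at some level, [small_multiple] gives a dense
   subset of [A] whose multiple at the next lower level is smaller by a factor
   beta ^ w. *)
Lemma exists_spreading (beta E w D i : nat) A :
  (0 < D)%N -> (1 < beta)%N -> (#|G| <= beta ^ E)%N -> A != set0 ->
  (#|msum (fun=> A) (scale E i)| < beta ^ (w * i))%N ->
  exists A1 : {set G}, [/\ A1 \subset A, A1 != set0, (#|A| <= D ^ i * #|A1|)%N &
    exists2 j, (j < i)%N &
      spreading A1 D (beta ^ w.+1) (scale E j * E).+1].
Proof.
move=> D_gt0 beta_gt1 leG; elim: i A => [|i IHi] A A0 small.
  have := @card_msum_gt0 G (fun=> A) (scale E 0) (fun _ _ => A0).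
  by move: small; rewrite muln0 expn0; case: #|_|.
pose h := scale E i; pose k := (h * E).+1.
have [sp|nsp] := pselect (spreading A D (beta ^ w.+1) k).
  exists A; split=> //; last by exists i.
  by rewrite leq_pmull // expn_gt0 D_gt0.
have [B sB /negP] := (existsPNP _ _).2 nsp; rewrite -ltnNge => failB.
have B0 j : (j < k)%N -> B j != set0.
  case/sB => _; apply: contraTneq => ->.
  by rewrite cards0 muln0 leqn0 cards_eq0.
have [j ltjk leBj] := small_multiple beta_gt1 leG B0.
have [sBA leA] := sB j ltjk.
have [|A1 [sA1 A10 leA1 [j' ltj' sp]]] := IHi (B j) (B0 j ltjk).
  (* Failure of spreading gains beta^(w + 1) and [small_multiple] gives back one factor beta,
     leaving a drop by beta^w. *)
  have beta_gt0 : (0 < beta ^ w.+1)%N by rewrite expn_gt0 ltnW.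
  rewrite -(ltn_pmul2l beta_gt0);
    apply: leq_ltn_trans (leq_mul (leqnn _) leBj) _.
  rewrite mulnCA; apply: (@leq_trans (beta * beta ^ (w * i.+1)))%N.
    rewrite ltn_pmul2l; last exact: ltnW.
    by apply: ltn_trans failB small.
  by rewrite -expnS -expnD leq_exp2l // mulnS; lia.
exists A1; split=> //; first exact: subset_trans sA1 sBA.
  by apply: leq_trans leA _; rewrite expnS -mulnA leq_mul2l leA1 orbT.
by exists j' => //; apply: ltnW.
Qed.

End Regularity.

(** * Robust sums *)

Lemma leq_card_bigcup (I T : finType) (P : pred I) (F : I -> {set T}) :
  (#|\bigcup_(i | P i) F i| <= \sum_(i | P i) #|F i|)%N.
Proof.
elim/big_rec2: _ => [|i n X _ leX]; first by rewrite cards0.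
by rewrite (leq_trans (leq_card_setU _ _)) // leq_add2l.
Qed.

Lemma leq_card_bigcup_const (I T : finType) (P : {set I}) (F : I -> {set T}) c :
  (forall i, i \in P -> #|F i| <= c)%N ->
  (#|\bigcup_(i in P) F i| <= #|P| * c)%N.
Proof.
move=> leF; apply: leq_trans (leq_card_bigcup _ _) _.
by rewrite -sum_nat_const; apply: leq_sum.
Qed.

Lemma bin_mul_sub n l k : (k <= l)%N -> (l <= n)%N ->
  ('C(n, l) * 'C(l, k) = 'C(n, k) * 'C(n - k, l - k))%N.
Proof.
move=> lekl leln; have lekn := leq_trans lekl leln.
have pos : (0 < k`! * (l - k)`! * (n - l)`!)%N by rewrite !muln_gt0 !fact_gt0.
apply/eqP; rewrite -(eqn_pmul2r pos); apply/eqP.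
have -> : ('C(n, l) * 'C(l, k) * (k`! * (l - k)`! * (n - l)`!) =
  'C(n, l) * (('C(l, k) * (k`! * (l - k)`!)) * (n - l)`!))%N by lia.
have -> : ('C(n, k) * 'C(n - k, l - k) * (k`! * (l - k)`! * (n - l)`!) =
  'C(n, k) * (k`! * ('C(n - k, l - k) * ((l - k)`! * (n - l)`!))))%N by lia.
rewrite bin_fact // bin_fact //.
have -> : (n - l = (n - k) - (l - k))%N by lia.
by rewrite !bin_fact //; lia.
Qed.

(* First moment: a uniformly random [l]-subset of [A] contains fewer than one
   member of [bad] on average. *)
Lemma avoiding_subset (T : finType) (A : {set T}) (bad : {set {set T}}) k l :
  (k <= l)%N -> (l <= #|A|)%N ->
  (forall X, X \in bad -> X \subset A /\ #|X| = k) ->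
  (#|bad| * 'C(l, k) < 'C(#|A|, k))%N ->
  exists2 A' : {set T}, A' \subset A /\ #|A'| = l &
    forall X, X \in bad -> ~~ (X \subset A').
Proof.
move=> lekl lelA badP few.
pose D := [set A' : {set T} | A' \subset A & #|A'| == l].
pose E (X : {set T}) := [set A' in D | X \subset A'].
have [sD|] := boolP (D \subset \bigcup_(X in bad) E X); last first.
  case/subsetPn => A'; rewrite inE => /andP[sA' /eqP cA'] nA'.
  exists A' => // X Xbad; apply: contra nA' => sX.
  by apply/bigcupP; exists X => //; rewrite !inE sA' cA' eqxx.
have leE X : X \in bad -> (#|E X| <= 'C(#|A| - k, l - k))%N.
  case/badP => sXA cX.
  have -> : (#|A| - k = #|A :\: X|)%N by rewrite cardsD (setIidPr sXA) cX.
  rewrite -cards_draws.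
  have inj : {in E X &, injective (fun A' => A' :\: X)}.
    move=> A1 A2; rewrite !inE => /andP[_ /setIidPr s1] /andP[_ /setIidPr s2] e.
    by rewrite -(setID A1 X) -(setID A2 X) e s1 s2.
  rewrite -(card_in_imset inj); apply/subset_leq_card/subsetP => Y /imsetP[A'].
  rewrite !inE => /andP[/andP[sA' /eqP cA'] /setIidPr sX] ->.
  by rewrite setSD //= cardsD sX cA' cX.
have := leq_trans (subset_leq_card sD) (leq_card_bigcup_const leE).
rewrite cards_draws => le1.
have pos : (0 < 'C(#|A| - k, l - k))%N by rewrite bin_gt0 leq_sub2r.
have: ('C(#|A|, k) * 'C(#|A| - k, l - k)
       <= #|bad| * 'C(l, k) * 'C(#|A| - k, l - k))%N.
  by rewrite -bin_mul_sub // mulnAC leq_mul2r le1 orbT.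
by rewrite leq_pmul2r // leqNgt few.
Qed.

Section Robust.
Variables (G : finZmodType) (A : {set G}) (M : nat).
Implicit Types (F X Y : {set G}) (s t z : G) (r : nat).

Definition setsum X : G := \sum_(x in X) x.

Definition avoids F r s :=
  [exists X : {set G}, [&& X \subset A :\: F, #|X| == r & setsum X == s]].

(* Bounding #|F| + r instead of #|F| makes robust sums add up ([robustD]) without
   changing [M]. *)
Definition robust r s :=
  [forall F : {set G}, (#|F| + r <= M)%N ==> avoids F r s].

(* A set met by all representations of a sum [s] that is not robust, and [set0]
   when [s] is robust. *)
Definition blocker r s : {set G} :=
  odflt set0 [pick F : {set G} | (#|F| + r <= M)%N && ~~ avoids F r s].

Lemma card_blocker r s : (#|blocker r s| <= M)%N.
Proof.
rewrite /blocker; case: pickP => [F /andP[leF _]|_] /=; last by rewrite cards0.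
exact: leq_trans (leq_addr _ _) leF.
Qed.

Lemma blockerP r s X : ~~ robust r s ->
  X \subset A -> #|X| = r -> setsum X = s ->
    exists2 f, f \in X & f \in blocker r s.
Proof.
move=> nrob sXA cX sX; rewrite /blocker; case: pickP => [F /andP[_]|none] /=.
  rewrite negb_exists => /forallP/(_ X); rewrite cX sX !eqxx !andbT.
  rewrite subsetD sXA /= => /pred0Pn[f /andP[/= fX fF]].
  by exists f.
case/negP: nrob; apply/forallP => F; apply/implyP => leF.
by have := none F; rewrite leF /= => /negbFE.
Qed.

Lemma robustP r s F : robust r s -> (#|F| + r <= M)%N ->
  exists X, [/\ X \subset A, [disjoint X & F], #|X| = r & setsum X = s].
Proof.
move=> /forallP/(_ F)/implyP rob /rob/existsP[X /and3P[]].
by rewrite subsetD => /andP[sXA dXF] /eqP cX /eqP sX; exists X.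
Qed.

Lemma setsumU X Y : [disjoint X & Y] -> setsum (X :|: Y) = setsum X + setsum Y.
Proof. by move=> dXY; rewrite /setsum -bigU //; apply: eq_bigl => x;
  rewrite !inE. Qed.

Lemma cardsU_disjoint X Y : [disjoint X & Y] -> #|X :|: Y| = (#|X| + #|Y|)%N.
Proof. by move=> dXY; rewrite cardsU disjoint_setI0 // cards0 subn0. Qed.

Lemma robustD r r' s s' : robust r s -> robust r' s' ->
  robust (r + r') (s + s').
Proof.
move=> rob rob'; apply/forallP => F; apply/implyP => leF.
have [|X [sX dX cX eX]] := robustP (F := F) rob; first lia.
have [|Y [sY dY cY eY]] := robustP (F := F :|: X) rob'.
  have leU : (#|F :|: X| <= #|F| + #|X|)%N by apply: leq_card_setU.
  by rewrite cX in leU; lia.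
move: dY; rewrite disjoint_sym disjoints_subset subUset -!disjoints_subset.
case/andP => dFY dXY.
apply/existsP; exists (X :|: Y);
  rewrite cardsU_disjoint // setsumU // cX cY eX eY.
rewrite !eqxx !andbT subsetD subUset sX sY /=.
by rewrite disjoints_subset subUset -!disjoints_subset dX disjoint_sym.
Qed.

Lemma robust0 : robust 0 0.
Proof.
apply/forallP => F; apply/implyP => _; apply/existsP; exists set0.
by rewrite sub0set cards0 /setsum big_set0 !eqxx.
Qed.

Lemma robust_sum (k : nat) (r : nat -> nat) (s : nat -> G) :
  (forall i, (i < k)%N -> robust (r i) (s i)) ->
  robust (\sum_(i < k) r i) (\sum_(i < k) s i).
Proof.
elim: k => [|k IHk] rob; first by rewrite !big_ord0 robust0.
rewrite !big_ord_recr robustD ?rob // IHk // => i /ltnW; exact: rob.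
Qed.

Variable d : nat.

(** The elements that can be traded: r + 1 elements with sum [t] may be replaced by [z] and any of
    the many representations of t - z by r elements. *)
Definition flex r t : {set G} := [set z in A | robust r (t - z)].

Definition strong r t := (#|A| <= d * #|flex r t|)%N.

(** One of the |Y| terms is traded for an element of [flex], hence the [.-1]. Quantifying over all
    subsets makes weakness hereditary, as the counting induction requires. *)
Definition weak X := [forall Y : {set G},
  (Y \subset X) && (Y != set0) ==> ~~ strong #|Y|.-1 (setsum Y)].

Lemma weakS X Y : Y \subset X -> weak X -> weak Y.
Proof.
move=> sYX /forallP wX; apply/forallP => Z; apply/implyP => /andP[sZ Z0].
by have /implyP := wX Z; apply; rewrite (subset_trans sZ).
Qed.

Definition weak_sets r s : {set {set G}} :=
  [set X : {set G} | [&& X \subset A, #|X| == r, setsum X == s & weak X]].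

Lemma setsumD1 X x : x \in X -> setsum (X :\ x) = setsum X - x.
Proof. by move=> xX; rewrite /setsum [in RHS](big_setD1 x xX) /= addrAC subrr
  add0r. Qed.

Lemma weak_setsD1 r s X x : X \in weak_sets r.+1 s -> x \in X ->
  X :\ x \in weak_sets r (s - x).
Proof.
rewrite !inE => /and4P[sXA /eqP cX /eqP sX wX] xX.
rewrite (subset_trans (subsetDl _ _)) // setsumD1 // sX eqxx.
rewrite (weakS (subsetDl _ _)) //= andbT.
by move: cX; rewrite (cardsD1 x) xX add1n => -[->].
Qed.

(* Given the sum [s] of a weak set and a member [z], either [s - z] is robust,
   and then [z] is in the small set [flex r.+1 s],
     or one of the other members is
   in the blocker of [s - z].  Either way few choices remain. *)
Lemma weak_sets_cover r s : weak_sets r.+2 s \subset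
  \bigcup_(z in flex r.+1 s) [set z |: X | X in weak_sets r.+1 (s - z)] :|:
  \bigcup_(z in A) \bigcup_(f in blocker r.+1 (s - z))
     [set z |: (f |: X) | X in weak_sets r (s - z - f)].
Proof.
apply/subsetP => X wX; have := wX; rewrite inE => /and4P[sXA /eqP cX /eqP sX _].
have [z zX] : exists z, z \in X by apply/set0Pn; rewrite -card_gt0 cX.
have wX1 := weak_setsD1 wX zX; have zA := subsetP sXA z zX.
have := wX1; rewrite inE => /and4P[sX1A /eqP cX1 /eqP sX1 _].
rewrite inE; apply/orP; have [rob|nrob] := boolP (robust r.+1 (s - z)).
  left; apply/bigcupP; exists z; first by rewrite inE zA.
  by apply/imsetP; exists (X :\ z); rewrite ?setD1K.
right; have [f fX1 fF] := blockerP nrob sX1A cX1 sX1.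
apply/bigcupP; exists z => //; apply/bigcupP; exists f => //.
by apply/imsetP; exists (X :\ z :\ f); rewrite ?weak_setsD1 // !setD1K.
Qed.

Lemma weak_sets_flex r s X : X \in weak_sets r.+1 s ->
  (d * #|flex r s| < #|A|)%N.
Proof.
rewrite inE => /and4P[_ /eqP cX /eqP sX /forallP/(_ X)/implyP].
by rewrite subxx -card_gt0 cX sX /strong -ltnNge; apply.
Qed.

Hypotheses (d_gt1 : (1 < d)%N) (leMA : (d * M <= #|A|)%N) (A_gt0 : (0 <
  #|A|)%N).

(** In [weak_sets_cover] the first union offers at most |A| / d choices of [z]; the second offers
    |A| choices of [z] and M <= |A| / d choices of [f]. So every two elements save a factor d /
    2. *)
Lemma card_weak_sets r s :
  (d ^ r./2 * #|weak_sets r s| <= 2 ^ r./2 * #|A| ^ r)%N.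
Proof.
set N := #|A|; have d_gt0 : (0 < d)%N by lia.
(* The recursion reaches back to both r and r + 1, so two consecutive bounds are carried. *)
suff [//] : (forall s, d ^ r./2 * #|weak_sets r s| <= 2 ^ r./2 * N ^ r)%N /\
  (forall s, d ^ (r.+1)./2 * #|weak_sets r.+1 s| <= 2 ^ (r.+1)./2 * N ^ r.+1)%N.
elim: r {s} => [|r [IH0 IH1]].
  rewrite /= !expn0 mul1n expn1; split=> s; rewrite !mul1n ?muln1.
    rewrite -[leqRHS](cards1 (set0 : {set G}));
      apply/subset_leq_card/subsetP => X.
    by rewrite !inE => /and3P[_]; rewrite cards_eq0.
  apply: (leq_trans _ A_gt0); rewrite -[leqRHS](cards1 [set s]).
  apply/subset_leq_card/subsetP => X; rewrite !inE => /and4P[_ cX + _].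
  by case/cards1P: cX => x ->; rewrite /setsum big_set1 => /eqP->.
split=> // s; rewrite /=.
have [->|[X wX]] := set_0Vmem (weak_sets r.+2 s); first by rewrite cards0 muln0.
have ltB := weak_sets_flex wX.
have le1 t : (d ^ r./2 * #|weak_sets r.+1 t| <= 2 ^ r./2 * N ^ r.+1)%N.
  have := IH1 t; rewrite [r.+1./2]/= uphalf_half; case: (odd r) => //=.
  rewrite add1n ![(_ ^ _./2.+1)%N]expnS -!mulnA => le2.
  rewrite -(leq_pmul2l d_gt0); apply: leq_trans le2 _.
  by rewrite leq_mul2r d_gt1 orbT.
apply: leq_trans (_ : d ^ r./2.+1 * (#|flex r.+1 s| * \max_t #|weak_sets r.+1 t|
    + N * (M * \max_t #|weak_sets r t|)) <= _)%N.
  rewrite leq_mul2l; apply/orP; right.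
  apply: leq_trans (subset_leq_card (weak_sets_cover _ _)) _.
  apply: leq_trans (leq_card_setU _ _) (leq_add _ _).
    apply: leq_card_bigcup_const => z _;
      apply: leq_trans (leq_imset_card _ _) _.
    exact: leq_bigmax.
  apply: leq_card_bigcup_const => z _.
  apply: leq_trans (leq_card_bigcup_const (c := \max_t #|weak_sets r t|) _) _.
    move=> f _; apply: leq_trans (leq_imset_card _ _) _.
    exact: (leq_bigmax (s - z - f)).
  by rewrite leq_mul2r card_blocker orbT.
have G_gt0 : (0 < #|G|)%N by apply/card_gt0P; exists 0.
have [t1 ->] := @bigop.eq_bigmax G (fun t => #|weak_sets r.+1 t|) G_gt0.
have [t0 ->] := @bigop.eq_bigmax G (fun t => #|weak_sets r t|) G_gt0.
have := le1 t1; have := IH0 t0; move: (ltB) (leMA); rewrite !expnS -/N.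
move: #|flex _ _| #|weak_sets r t0| #|weak_sets r.+1 t1| => f w0 w1.
move: (N) (d ^ _)%N (2 ^ _)%N (N ^ _)%N => N0 D T P.
move=> {}ltB {}leM le_w0 le_w1.
have h1 : (d * f * (D * w1) <= N0 * (T * (N0 * P)))%N.
  by apply: leq_mul le_w1; apply: ltnW.
have h2 : (d * M * (D * w0) <= N0 * (T * P))%N by apply: leq_mul.
have h3 : (N0 * (d * M * (D * w0)) <= N0 * (N0 * (T * P)))%N by rewrite
  leq_mul2l h2 orbT.
lia.
Qed.

End Robust.

(** * Absorption *)

(** Greedy choice: the sets already chosen cover at most (n - 1) m elements of the next one. *)
Lemma disjoint_subfamily (T : finType) (B : nat -> {set T}) (n m : nat) :
  (forall i, (i < n)%N -> (n * m <= #|B i|)%N) ->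
  exists C : nat -> {set T},
    (forall i, (i < n)%N -> C i \subset B i /\ #|C i| = m) /\
    (forall i j, (i < j < n)%N -> [disjoint C i & C j]).
Proof.
suff: forall l, (l <= n)%N -> (forall i, (i < l)%N -> (n * m <= #|B i|)%N) ->
  exists C : nat -> {set T},
    (forall i, (i < l)%N -> C i \subset B i /\ #|C i| = m) /\
    (forall i j, (i < j < l)%N -> [disjoint C i & C j]) by apply.
elim=> [|l IHl] ltln leB; first by exists (fun=> set0); split=> // i j; lia.
have [|C [CB dC]] := IHl (ltnW ltln); first by move=> i ltil; apply: leB; lia.
pose U := \bigcup_(i : 'I_l) C i.
have leU : (#|U| <= l * m)%N.
  apply: leq_trans (leq_card_bigcup _ _) _.
  rewrite (eq_bigr (fun=> m)) => [|i _]; last by rewrite (CB i (ltn_ord i)).2.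
  by rewrite sum_nat_const card_ord.
have leBU : (m <= #|B l :\: U|)%N.
  have := leB l (ltnSn l); rewrite -(cardsID U (B l)).
  have : (#|B l :&: U| <= #|U|)%N by rewrite subset_leq_card ?subsetIr.
  by nia.
have [D sD cD] : exists2 D : {set T}, D \subset B l :\: U & #|D| = m.
  have /card_gt0P[D] : (0 < #|[set D : {set T} | D \subset B l :\: U & #|D| ==
    m]|)%N.
    by rewrite cards_draws bin_gt0.
  by rewrite inE => /andP[sD /eqP cD]; exists D.
move: sD; rewrite subsetD => /andP[sDB dDU].
exists (fun i => if i == l then D else C i); split=> [i|i j].
  by rewrite ltnS leq_eqVlt; case: eqP => [->//|_ /= /CB].
move=> /andP[ltij]; rewrite ltnS => lejl;
  rewrite (ltn_eqF (leq_trans ltij lejl)).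
have [_|nejl] := eqVneq j l; last by apply: dC; lia.
have ltil := leq_trans ltij lejl.
rewrite disjoint_sym; apply: disjointWr dDU.
by apply: (bigcup_sup (Ordinal ltil)).
Qed.

(** The first hypotheses make u and v larger than (2k + 1) S, so the 2k + 1 terms u S or v S of the
    last one add up to less than u v. *)
Lemma pairs_contradiction k c y u v l S :
  (l <= c * u)%N -> (l <= c * v)%N -> (y * S < l)%N -> ((k.*2).+1 * c <= y)%N ->
  (u * v <= u * S + (k * (u * S) + k * (v * S)))%N -> False.
Proof.
move=> leu lev ltS ley main.
have hu : (y * S < c * u)%N by lia.
have hv : (y * S < c * v)%N by lia.
have u0 : (0 < u)%N by case: u hu {leu main} => //; rewrite muln0.
have h1 := leq_mul (leqnn y) main.
have h2 : (k * v * (y * S) <= k * v * (c * u))%N by rewrite leq_mul2l (ltnW hu)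
  orbT.
have h3 : (k * u * (y * S) <= k * u * (c * v))%N by rewrite leq_mul2l (ltnW hv)
  orbT.
have h4 : (u * (y * S) < u * (c * v))%N by rewrite ltn_pmul2l.
have h5 : ((k.*2).+1 * c * (u * v) <= y * (u * v))%N by rewrite leq_mul2r ley
  orbT.
lia.
Qed.

Section Absorption.
Variables (G : finZmodType) (A : {set G}) (M k y : nat).
Hypotheses (A0 : A != set0) (y_gt0 : (0 < y)%N).
Local Notation n1 := (k.*2).+1.
Local Notation Lam := (msum (fun=> A) n1).
Implicit Types (s b : G).

Definition blocked b : {set G} :=
  [set s in Lam | ~~ robust A M n1 s & b \in blocker A M n1 s].

Definition heavy : {set G} := [set b in A | (#|Lam| <= y * #|blocked b|)%N].

Lemma Lam_gt0 : (0 < #|Lam|)%N.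
Proof. exact: card_msum_gt0. Qed.

(** Double counting of pairs of an element and a sum that it blocks: a sum has at most M blocking
    elements, and a heavy element blocks at least |Lam| / y sums. *)
Lemma card_heavy : (#|heavy| <= y * M)%N.
Proof.
rewrite -(leq_pmul2r Lam_gt0) -sum_nat_const.
apply: (@leq_trans (\sum_(b in heavy) y * #|blocked b|)%N).
  by apply: leq_sum => b; rewrite inE => /andP[].
rewrite -big_distrr /= -mulnA leq_pmul2l //.
apply: (@leq_trans (\sum_(b in heavy) \sum_(s in Lam) (b \in blocker A M n1
  s))%N).
  apply: leq_sum => b _; rewrite -sum1_card big_mkcond [leqRHS]big_mkcond /=.
  apply: leq_sum => s _; rewrite inE; case: (s \in Lam) => //=.
  by case: (robust _ _ _ _) => //=; case: (b \in _).
rewrite exchange_big /= mulnC -sum_nat_const; apply: leq_sum => s _.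
apply: leq_trans (card_blocker A M n1 s).
rewrite -sum1_card big_mkcond [leqRHS]big_mkcond /=.
by apply: leq_sum => b _; case: (b \in heavy) => //; case: (b \in _).
Qed.

(** For fixed [p.1] the sum determines [p.2], so at most [S] values of [p.2] remain. *)
Lemma card_blocked_pairs a (Z Z' : {set G}) (g : G -> G) S :
  (forall s, s \in Z -> #|blocked (g s)| <= S)%N ->
  (#|[set p in setX Z Z' | (a + p.1 + p.2)%R \in blocked (g p.1)]| <= #|Z| *
    S)%N.
Proof.
move=> leS.
pose U s := [set (s, u - (a + s)) | u in blocked (g s)].
have leU s : s \in Z -> (#|U s| <= S)%N.
  by move=> sZ; apply: leq_trans (leq_imset_card _ _) (leS s sZ).
apply: leq_trans (leq_card_bigcup_const leU).
apply/subset_leq_card/subsetP => -[s s'];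
  rewrite !inE /= -!andbA => /and3P[sZ _ bl].
apply/bigcupP; exists s => //; apply/imsetP; exists (a + s + s');
  first by rewrite inE.
by rewrite [a + s + s']addrC addrK.
Qed.

Lemma card_blocked_pairs' a (Z Z' : {set G}) (g : G -> G) S :
  (forall s, s \in Z' -> #|blocked (g s)| <= S)%N ->
  (#|[set p in setX Z Z' | (a + p.1 + p.2)%R \in blocked (g p.2)]| <= #|Z'| *
    S)%N.
Proof.
move=> leS; apply: leq_trans (@card_blocked_pairs a Z' Z g S leS).
have sw : injective (fun p : G * G => (p.2, p.1)) by move=> [x1 x2] [? ?] [->
  ->].
rewrite -(card_imset _ sw); apply/subset_leq_card/subsetP =>
  _ /imsetP[[s s'] + ->].
by rewrite !inE /= andbC [(_ \in Z) && _]andbC addrAC andbC.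
Qed.

(* Let Z and Z' be the sums of the first and of the last [k] sets [C i].  If all
   a + s + s' were blocked, then each of them would be blocked by [a],
     by a summand
   of [s] or by a summand of [s'].  These elements are not heavy, and since the
   summands of [s] do not depend on [s'] (nor conversely), there are fewer than
   |Z| |Z'| such pairs. *)
Lemma exists_robust_sum a (C : nat -> {set G}) c :
  a \in A :\: heavy ->
  (forall i, (i < k.*2)%N -> [/\ C i \subset A :\: heavy,
    a \notin C i & C i != set0]) ->
  (forall i j, (i < j < k.*2)%N -> [disjoint C i & C j]) ->
  (#|Lam| <= c * #|msum C k|)%N ->
  (#|Lam| <= c * #|msum (fun i => C (k + i)%N) k|)%N ->
  (n1 * c <= y)%N ->
  exists2 z : nat -> G, (forall i, (i < k.*2)%N -> z i \in C i) &
    robust A M n1 (a + \sum_(i < k.*2) z i).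
Proof.
move=> aA sC dC leZ leZ' ley.
set Z := msum C k; set Z' := msum (fun i => C (k + i)%N) k.
have /choice[tau tauP] : forall s, exists z : nat -> G, s \in Z ->
    (forall i, (i < k)%N -> z i \in C i) /\ s = \sum_(i < k) z i.
  move=> s; have [/msumP[z zC ->]|nZ] := boolP (s \in Z); first by exists z.
  by exists (fun=> 0).
have /choice[tau' tau'P] : forall s, exists z : nat -> G, s \in Z' ->
    (forall i, (i < k)%N -> z i \in C (k + i)%N) /\ s = \sum_(i < k) z i.
  move=> s; have [/msumP[z zC ->]|nZ] := boolP (s \in Z'); first by exists z.
  by exists (fun=> 0).
pose z s s' i := if (i < k)%N then tau s i else tau' s' (i - k)%N.
have zC s s' i : s \in Z -> s' \in Z' -> (i < k.*2)%N -> z s s' i \in C i.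
  move=> /tauP[h _] /tau'P[h' _] lti; rewrite /z; case: ltnP => [/h //|leki].
  by have := h' (i - k)%N; rewrite subnKC //; apply; lia.
have sumz s s' : s \in Z -> s' \in Z' -> \sum_(i < k.*2) z s s' i = s + s'.
  move=> /tauP[_ {2}->] /tau'P[_ {2}->]; rewrite -addnn big_split_ord /=.
  congr (_ + _); apply: eq_bigr => i _; rewrite /z ?ltn_ord //=.
  by rewrite ltnNge leq_addr /= addKn.
have [/existsP[[s s'] /andP[/=]]|] := boolP [exists p : G * G,
    (p \in setX Z Z') && robust A M n1 (a + p.1 + p.2)].
  rewrite inE => /andP[/= sZ s'Z'] rob; exists (z s s') => [i|].
    exact: zC.
  by rewrite sumz // addrA.
rewrite negb_exists => /forallP none; exfalso.
(* The largest integer with y S < |Lam|; an element of [A] that is not heavy blocks at most [S]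
   sums. *)
pose S := (#|Lam|.-1 %/ y)%N.
have ltS : (y * S < #|Lam|)%N.
  by rewrite mulnC (leq_ltn_trans (leq_trunc_div _ _)) // prednK ?Lam_gt0.
have leS b : b \in A :\: heavy -> (#|blocked b| <= S)%N.
  rewrite !inE andbC => /andP[-> /=]; rewrite -ltnNge => ltb.
  by rewrite leq_divRL // mulnC -ltnS prednK ?Lam_gt0.
have tauS i s : (i < k)%N -> s \in Z -> (#|blocked (tau s i)| <= S)%N.
  move=> ltik /tauP[h _]; apply: leS; have [|sCi _ _] := sC i; first by lia.
  exact: (subsetP sCi _ (h i ltik)).
have tau'S i s : (i < k)%N -> s \in Z' -> (#|blocked (tau' s i)| <= S)%N.
  move=> ltik /tau'P[h _]; apply: leS; have [|sCi _ _] := sC (k + i)%N;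
    first by lia.
  exact: (subsetP sCi _ (h i ltik)).
pose U0 := [set p in setX Z Z' | (a + p.1 + p.2)%R \in blocked a].
pose U (i : 'I_k) := [set p in setX Z Z' | (a + p.1 + p.2)%R \in blocked (tau
  p.1 i)].
pose U' (i : 'I_k) := [set p in setX Z Z' | (a + p.1 + p.2)%R \in blocked (tau'
  p.2 i)].
have cover : setX Z Z' \subset U0 :|: (\bigcup_i U i :|: \bigcup_i U' i).
  apply/subsetP => -[s s'] pZ; have := none (s, s'); rewrite pZ /= => nrob.
  have := pZ; rewrite inE => /andP[/= sZ s'Z'].
  (* [a] takes the last index. Since the C i are disjoint and avoid [a], these 2k + 1 elements are
     distinct and represent a + s + s', so one of them lies in its blocker. *)
  pose zz (i : 'I_n1) := if (i < k.*2)%N then z s s' i else a.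
  have zzA i : zz i \in A.
    rewrite /zz; case: ifP => [lti|_]; last by have := aA;
      rewrite !inE => /andP[].
    have [sCi _ _] := sC _ lti.
    by have := subsetP sCi _ (zC s s' i sZ s'Z' lti); rewrite !inE => /andP[].
  have zz_lt (i j : 'I_n1) : (i < j)%N -> zz i <> zz j.
    move=> ltij; rewrite /zz; have lti : (i < k.*2)%N by have := ltn_ord j; lia.
    rewrite lti; have zi := zC s s' i sZ s'Z' lti; case: ifP => ltj e.
      have dij : [disjoint C i & C j] by apply: dC; rewrite ltij.
      by have := disjointFr dij zi; rewrite e zC.
    by have [_ /negP + _] := sC i lti; apply; rewrite -e.
  have zz_inj : injective zz.
    move=> i j e; apply: val_inj; case: (ltngtP i j) => [ltij|ltji|//].
      by case: (zz_lt i j ltij e).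
    by case: (zz_lt j i ltji (esym e)).
  pose X := [set zz i | i : 'I_n1].
  have cX : #|X| = n1 by rewrite card_imset // card_ord.
  have sX : setsum X = a + s + s'.
    rewrite /setsum big_imset /=; last by move=> i j _ _; apply: zz_inj.
    rewrite big_ord_recr /= {2}/zz /= ltnn -addrA -(sumz s s') // [RHS]addrC.
    congr (_ + _).
    by apply: eq_bigr => i _; rewrite /zz /= ltn_ord.
  have sXA : X \subset A by apply/subsetP => _ /imsetP[i _ ->].
  have sLam : a + s + s' \in Lam.
    rewrite -sX /setsum big_imset /=; last by move=> i j _ _; apply: zz_inj.
    rewrite (eq_bigr (fun i : 'I_n1 =>
      if (i < k.*2)%N then z s s' i else a)) //.
    apply: (@mem_msum _ _ _ (fun i => if (i < k.*2)%N then z s s' i else a)).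
    by move=> i lti; apply: (zzA (Ordinal lti)).
  have [f /imsetP[i _ ->] fb] := blockerP nrob sXA cX sX.
  have bl : a + s + s' \in blocked (zz i) by rewrite inE sLam nrob.
  move: bl; rewrite /zz /z; case: ltnP => [lti|_ bl]; last first.
    by apply/setUP; left; rewrite inE pZ.
  case: ltnP => [ltik|leki] bl; apply/setUP; right; apply/setUP.
    by left; apply/bigcupP; exists (Ordinal ltik); rewrite // inE pZ.
  right; have ltik : (i - k < k)%N by rewrite ltn_subLR // addnn.
  by apply/bigcupP; exists (Ordinal ltik); rewrite // inE pZ.
have le0 : (#|U0| <= #|Z| * S)%N by apply: (card_blocked_pairs a _ (g :=
  fun=> a)); auto.
have le1 : (#|\bigcup_i U i| <= k * (#|Z| * S))%N.
  apply: leq_trans (leq_card_bigcup _ _) _.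
  apply: (@leq_trans (\sum_(i < k) #|Z| * S)%N).
    apply: leq_sum => i _; apply: (card_blocked_pairs a _ (g :=
      fun s => tau s i)).
    by move=> s; apply: tauS.
  by rewrite sum_nat_const card_ord.
have le2 : (#|\bigcup_i U' i| <= k * (#|Z'| * S))%N.
  apply: leq_trans (leq_card_bigcup _ _) _.
  apply: (@leq_trans (\sum_(i < k) #|Z'| * S)%N).
    apply: leq_sum => i _; apply: (card_blocked_pairs' a _ (g :=
      fun s => tau' s i)).
    by move=> s; apply: tau'S.
  by rewrite sum_nat_const card_ord.
have := subset_leq_card cover; rewrite cardsX => leZZ.
have leU : (#|U0 :|: (\bigcup_i U i :|: \bigcup_i U' i)| <=
   #|U0| + (#|\bigcup_i U i| + #|\bigcup_i U' i|))%N.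
  apply: leq_trans (leq_card_setU _ _) _; rewrite leq_add2l;
    exact: leq_card_setU.
apply: (pairs_contradiction leZ leZ' ltS ley).
exact: leq_trans leZZ (leq_trans leU (leq_add le0 (leq_add le1 le2))).
Qed.

End Absorption.

(** * Absorbing a list of elements *)

Section AbsorbMany.
Variables (G : finZmodType) (A : {set G}) (M d D c k m K0 : nat).
Local Notation n1 := (k.*2).+1.
Local Notation y := (n1 * c)%N.
Implicit Types (X S : {set G}) (a : G).
Hypotheses (A0 : A != set0) (c_gt0 : (0 < c)%N) (d_gt0 : (0 < d)%N).
Hypothesis spA : spreading A D c k.
Hypotheses (m_gt0 : (0 < m)%N) (leAm : (#|A| <= D * m)%N).
Hypothesis leA : (d * (k.*2 * m + (y * M).+1) <= #|A|)%N.
Local Notation hv := (heavy A M k y).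

(** Write t i = z i + (t i - z i) with z i in [flex], so that t i - z i is robust. The z i come from
    disjoint subsets of [flex] avoiding [a] and the heavy elements; these are dense, so spreading
    gives a choice with a + sum of z i robust. *)
Lemma absorb_one a (r : nat -> nat) (t : nat -> G) : a \in A :\: hv ->
  (forall i, (i < k.*2)%N -> strong A M d (r i) (t i)) ->
  robust A M (n1 + \sum_(i < k.*2) r i) (a + \sum_(i < k.*2) t i).
Proof.
move=> aA st; have y_gt0 : (0 < y)%N by rewrite muln_gt0.
pose B i := flex A M (r i) (t i) :\: (a |: hv).
have leB i : (i < k.*2)%N -> (k.*2 * m <= #|B i|)%N.
  move=> /st; rewrite /strong => leF.
  have := leq_trans leA leF; rewrite leq_pmul2l // => {}leF.
  have leh : (#|a |: hv| <= (y * M).+1)%N.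
    rewrite cardsU1; have := card_heavy M k A0 y_gt0;
      case: (a \notin _) => /=; lia.
  rewrite cardsD.
  have : (#|flex A M (r i) (t i) :&: (a |: hv)| <= #|a |: hv|)%N.
    by rewrite subset_leq_card // subsetIr.
  lia.
have [C [sC dC]] := disjoint_subfamily leB.
have C0 i : (i < k.*2)%N -> C i != set0.
  by move=> lti; rewrite -card_gt0 (sC i lti).2.
have sCB i : (i < k.*2)%N -> C i \subset B i by move=> lti;
  rewrite (sC i lti).1.
have sCA i : (i < k.*2)%N -> C i \subset A.
  move=> lti; apply: subset_trans (sCB i lti) _.
  by apply: subset_trans (subsetDl _ _) _; apply/subsetP => z;
    rewrite inE => /andP[].
have [||||z zC rob] := @exists_robust_sum G A M k y A0 y_gt0 a C c aA _ dC.
- move=> i lti; split; last exact: C0.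
    apply/subsetP => z /(subsetP (sCB i lti)); rewrite !inE negb_or.
    by case/andP => /andP[_ ->] /andP[->].
  by apply/negP => /(subsetP (sCB i lti)); rewrite !inE eqxx.
- by apply: spA => i lti; rewrite sCA ?(sC i _).2; try lia.
- by apply: spA => i lti; rewrite sCA ?(sC (k + i)%N _).2; try lia.
- by [].
have -> : a + \sum_(i < k.*2) t i =
    a + \sum_(i < k.*2) z i + \sum_(i < k.*2) (t i - z i).
  rewrite -addrA -big_split /=; congr (_ + _).
  by apply: eq_bigr => i _; rewrite addrC subrK.
apply: robustD rob _; apply: (robust_sum (s := fun i => t i - z i)) => i lti.
by have := subsetP (sCB i lti) _ (zC i lti); rewrite !inE => /and3P[].
Qed.

Variable A' : {set G}.
Hypothesis sA' : A' \subset A :\: hv.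
Hypothesis strA' : forall X, X \subset A' -> #|X| = K0 -> ~~ weak A M d X.

(** Any [K0] elements of [A'] contain a nonempty strong subset; removing such subsets one at a time
    costs at most [K0] elements each. *)
Lemma extract_strong n S : S \subset A' -> (n * K0 <= #|S|)%N ->
  exists (X : nat -> {set G}) (S' : {set G}), [/\ S' \subset S,
    (forall i, (i < n)%N ->
       (0 < #|X i|)%N /\ strong A M d #|X i|.-1 (setsum (X i))),
    (#|S| <= #|S'| + n * K0)%N,
    #|S| = (#|S'| + \sum_(i < n) #|X i|)%N &
    setsum S = setsum S' + \sum_(i < n) setsum (X i)].
Proof.
elim: n S => [|n IHn] S sS leS.
  by exists (fun=> set0), S; rewrite !big_ord0 addn0 addr0; split=> //; lia.
have [X0 sX0 cX0] : exists2 X0 : {set G}, X0 \subset S & #|X0| = K0.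
  have /card_gt0P[X0] : (0 < #|[set X0 : {set G} | X0 \subset S & #|X0| ==
    K0]|)%N.
    by rewrite cards_draws bin_gt0; lia.
  by rewrite inE => /andP[sX0 /eqP cX0]; exists X0.
have := strA' (subset_trans sX0 sS) cX0.
rewrite negb_forall => /existsP[Y];
  rewrite negb_imply negbK => /andP[/andP[sYX Y0] stY].
have sYS := subset_trans sYX sX0; have := subset_leq_card sYX;
  rewrite cX0 => leY.
have cS : #|S| = (#|S :\: Y| + #|Y|)%N.
  by rewrite -(cardsID Y S) (setIidPr sYS) addnC.
have [||X [S' [sS' stX le_S' cS' eS']]] := IHn (S :\: Y).
- exact: subset_trans (subsetDl _ _) sS.
- by move: leS; rewrite cS mulSn; clear -leY; lia.
exists (fun i => if i == n then Y else X i), S'; split.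
- exact: subset_trans sS' (subsetDl _ _).
- move=> i; rewrite ltnS leq_eqVlt; case: eqP => [_ _|_ /= /stX//].
  by rewrite card_gt0.
- by clear -cS le_S' leY; lia.
- rewrite big_ord_recr /= eqxx cS cS' addnA; congr (_ + _ + _)%N.
  by apply: eq_bigr => i _; rewrite ltn_eqF.
rewrite big_ord_recr /= eqxx addrA.
rewrite (eq_bigr (fun i : 'I_n => setsum (X i))) => [|i _];
  last by rewrite ltn_eqF.
rewrite -eS' -setsumU; last by rewrite disjoints_subset setDE subsetIr.
by congr setsum; rewrite -[LHS](setID S Y) (setIidPr sYS) setUC.
Qed.

(** Each entry of [xs] is merged with 2k strong subsets of [S] into a robust sum, and robust sums
    add up. Only the number [R] of terms of [v] is recorded, as its elements can be chosen once S'
    is known. *)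
Lemma absorb_many (xs : seq G) S : {subset xs <= A'} -> S \subset A' ->
  (k.*2 * K0 * size xs <= #|S|)%N ->
  exists (S' : {set G}) (R : nat) (v : G), [/\ S' \subset S, robust A M R v,
    (R + #|S'| = size xs + #|S|)%N & v + setsum S' = \sum_(x <- xs) x + setsum
      S].
Proof.
elim: xs S => [|a xs IHxs] S sxs sS leS.
  by exists S, 0%N, 0; rewrite robust0 big_nil /= !add0n !add0r.
have [|X [S1 [sS1 stX leS1 cS1 eS1]]] := @extract_strong k.*2 S sS.
  by apply: leq_trans leS; rewrite /= mulnS leq_addr.
have [|||S' [R [v [sS' rob cS' eS']]]] := IHxs S1.
- by move=> x xxs; apply: sxs; rewrite inE xxs orbT.
- exact: subset_trans sS1 sS.
- by have := leq_trans leS leS1; rewrite /= mulnS addnC leq_add2r.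
have aA : a \in A :\: hv by apply: (subsetP sA'); apply: sxs; rewrite inE eqxx.
have rob1 := absorb_one aA (fun i lti => (stX i lti).2).
exists S', (n1 + \sum_(i < k.*2) #|X i|.-1 + R)%N,
  (a + \sum_(i < k.*2) setsum (X i) + v); split.
- exact: subset_trans sS' sS1.
- exact: robustD.
(* The 2k + 1 elements and the |X i| - 1 terms of each t i - z i replace [a] and the X i one for
   one. *)
- have -> : (n1 + \sum_(i < k.*2) #|X i|.-1 = (\sum_(i < k.*2) #|X i|).+1)%N.
    rewrite addSn; congr _.+1; rewrite -{1}[k.*2]card_ord -sum1_card -big_split
      /=.
    by apply: eq_bigr => i _; rewrite add1n prednK // (stX i (ltn_ord i)).1.
  by rewrite cS1 addSn addSn -addnA cS' /= addSn addnC -!addnA.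
rewrite big_cons eS1 -!addrA eS'; congr (_ + _).
by rewrite addrC -addrA.
Qed.

End AbsorbMany.

(** * Sampling an absorbing subset *)

Lemma leq_ffact n k j : (j <= k)%N -> ((n - k) ^ j <= n ^_ j)%N.
Proof.
elim: j => [|j IHj] ltjk //; rewrite expnSr ffactnSr leq_mul ?IHj //.
  exact: ltnW.
by rewrite leq_sub2l // ltnW.
Qed.

Lemma ffact_leq n k : (n ^_ k <= n ^ k)%N.
Proof. by elim: k => // k IHk; rewrite expnSr ffactnSr leq_mul // leq_subr. Qed.

Lemma card_weak (G : finZmodType) (A : {set G}) (M d r : nat) :
  (1 < d)%N -> (d * M <= #|A|)%N -> (0 < #|A|)%N ->
  (d ^ r * #|[set X : {set G} | [&& X \subset A, #|X| == r.*2 & weak A M d X]]|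
   <= #|G| * (2 ^ r * #|A| ^ r.*2))%N.
Proof.
move=> d_gt1 leMA A_gt0; set bad := [set X | _].
have sbad : bad \subset \bigcup_(s in [set: G]) weak_sets A M d r.*2 s.
  apply/subsetP => X; rewrite inE => /and3P[sX cX wX].
  by apply/bigcupP; exists (setsum X); rewrite !inE // sX cX eqxx.
apply: leq_trans (leq_mul (leqnn _) (subset_leq_card sbad)) _.
apply: leq_trans (leq_mul (leqnn _) (leq_card_bigcup _ _)) _.
rewrite big_distrr /= -cardsT -sum_nat_const; apply: leq_sum => s _.
by have := card_weak_sets d_gt1 leMA A_gt0 r.*2 s; rewrite doubleK.
Qed.

Definition reach (W j : nat) : nat := (scale (W * W) j * (W * W)).+1.
Definition max_reach (W : nat) : nat := (\sum_(j < W.+1) reach W j)%N.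
(** For K' = W^2 + 1 the saving beta^(4 K') exceeds beta^(3 K') |G| when |G| <= beta^(W^2). *)
Definition half_block (W : nat) : nat := (W * W).+1.

(** Passing to a spreading A1 costs at most a factor beta^(5 (W + 1)), leaving beta^(W + 8)
    elements. At least half of them are not heavy, and some beta-subset of these contains no weak
    set of size 2 (W^2 + 1). *)
Lemma exists_absorbing (W : nat) (G : finZmodType) (A : {set G}) (M beta : nat)
  :
  (0 < W)%N ->
  (8 * max_reach W + (half_block W).*2 + 8 <= beta)%N -> (M <= beta)%N ->
  (#|G| <= beta ^ (W * W))%N -> (beta ^ (6 * W + 13) <= #|A|)%N ->
  exists A1 A' : {set G}, [/\ A1 \subset A, A' \subset A1, #|A'| = beta &
    forall (xs : seq G) (S : {set G}), {subset xs <= A'} -> S \subset A' ->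
    ((max_reach W).*2 * (half_block W).*2 * size xs <= #|S|)%N ->
    exists (S' : {set G}) (R : nat) (v : G),
      [/\ S' \subset S, robust A1 M R v, (R + #|S'| = size xs + #|S|)%N &
          v + setsum S' = \sum_(x <- xs) x + setsum S]].
Proof.
move=> W_gt0 leb leM leG leA; set K' := half_block W.
have b_gt1 : (1 < beta)%N by lia.
have b_gt0 : (0 < beta)%N by lia.
have A0 : A != set0 by rewrite -card_gt0 (leq_trans _ leA) // expn_gt0 b_gt0.
have b5 : (0 < beta ^ 5)%N by rewrite expn_gt0 b_gt0.
have [|A1 [sA1 A10 leA1 [j ltjW spA]]] :=
    @exists_spreading G beta (W * W) W (beta ^ 5) W.+1 A b5 b_gt1 leG A0.
  (* W + 1 levels suffice because |G| <= beta^(W^2) < beta^(W (W + 1)). *)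
  apply: leq_ltn_trans (max_card _) (leq_ltn_trans leG _).
  by rewrite ltn_exp2l // mulnS; clear -W_gt0; lia.
set k := (_ * _).+1 in spA.
have lek : (k <= max_reach W)%N.
  by rewrite /max_reach (bigD1 (Ordinal ltjW)) //= leq_addr.
clearbody k; set N := #|A1|.
have leN : (beta ^ (W + 8) <= N)%N.
  rewrite -(@leq_pmul2l ((beta ^ 5) ^ W.+1)) ?expn_gt0 ?b_gt0 //.
  apply: (leq_trans _ leA1); apply: (leq_trans _ leA).
  by rewrite -expnM -expnD leq_exp2l //; clear; lia.
have N_gt0 : (0 < N)%N by rewrite card_gt0.
pose c := (beta ^ W.+1)%N; pose y := ((k.*2).+1 * c)%N; pose d := (beta ^ 4)%N.
have c_gt0 : (0 < c)%N by rewrite expn_gt0 b_gt0.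
have d_gt0 : (0 < d)%N by rewrite expn_gt0 b_gt0.
have len1 : ((k.*2).+1 <= beta)%N by clear -lek leb; lia.
have le_yM : (y * M <= beta ^ (W + 3))%N.
  have -> : (beta ^ (W + 3) = beta * c * beta)%N.
    by rewrite /c -expnS -expnSr; congr (_ ^ _)%N; clear; lia.
  by rewrite leq_mul // leq_mul.
have y_gt0 : (0 < y)%N by rewrite muln_gt0.
have bW3 : (0 < beta ^ (W + 3))%N by rewrite expn_gt0 b_gt0.
have bW8 : (beta ^ (W + 8) = beta ^ (W + 3) * beta ^ 5)%N by rewrite -expnD
  -addnA.
have le_b_b5 : (beta <= beta ^ 5)%N by rewrite -[leqLHS]expn1 leq_exp2l.
have le_b_bW3 : (beta <= beta ^ (W + 3))%N.
  by rewrite -[leqLHS]expn1 leq_exp2l // addnC.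
pose m := (N %/ beta ^ 5).+1.
have leAm : (#|A1| <= beta ^ 5 * m)%N by rewrite mulnC ltnW // ltn_ceil.
have leAd : (d * (k.*2 * m + (y * M).+1) <= #|A1|)%N.
  (* Multiplying by [beta] turns d = beta^4 into beta^5, the denominator in [m]. *)
  rewrite -(leq_pmul2l b_gt0) mulnA -expnS mulnDr /m mulnS.
  have h1 := leq_trunc_div N (beta ^ 5).
  have h2 : (2 * beta ^ (W + 8) * 2 <= beta * N)%N.
    have b4 : (4 <= beta)%N by clear -leb; lia.
    by apply: (leq_trans _ (leq_mul b4 leN)); clear; lia.
  have h3 : (k.*2 * 2 * N <= beta * N)%N.
    by rewrite leq_mul2r; apply/orP; right; clear -lek leb; lia.
  have h4 : (beta ^ 5 * (k.*2 + (y * M).+1) <= 2 * beta ^ (W + 8))%N.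
    rewrite bW8 mulnA [leqLHS]mulnC leq_mul2r; apply/orP; right.
    by clear -le_yM len1 le_b_bW3; lia.
  rewrite -/N; move: h1 h2 h3 h4.
  move: (beta ^ 5)%N (beta ^ (W + 8))%N (y * M)%N (N %/ beta ^ 5)%N =>
    b5' b8 yM q.
  clear; rewrite mulnDr => h1 h2 h3 h4.
  have h5 : (k.*2 * (q * b5') <= k.*2 * N)%N by rewrite leq_mul2l h1 orbT.
  by lia.
pose As := A1 :\: heavy A1 M k y.
have leAs : (N <= 2 * (#|As| - K'.*2))%N.
  have leh := leq_trans (card_heavy M k A10 y_gt0) le_yM.
  have : (N <= #|As| + #|heavy A1 M k y|)%N.
    rewrite -/N /N -(cardsID (heavy A1 M k y) A1) addnC leq_add2l.
    by rewrite subset_leq_card // subsetIr.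
  have : (4 * beta ^ (W + 3) <= N)%N.
    apply: (leq_trans _ leN); rewrite bW8 mulnC leq_mul2l; apply/orP; right.
    by clear -le_b_b5 leb; lia.
  by clear -leh leb le_b_bW3; lia.
pose bad := [set X : {set G} | [&& X \subset As,
  #|X| == K'.*2 & weak A1 M d X]].
(* The saving d^K' of [card_weak] beats |G|, 8^K' and beta^(2 K'). Here 8^K' contains 2^(2 K'), the
   price of passing from A1 to [As]. *)
have few : (#|bad| * 'C(beta, K'.*2) < 'C(#|As|, K'.*2))%N.
  have sbad : (#|bad| <= #|[set X : {set G} |
      [&& X \subset A1, #|X| == K'.*2 & weak A1 M d X]]|)%N.
    apply/subset_leq_card/subsetP => X; rewrite !inE => /and3P[sX -> ->].
    by rewrite (subset_trans sX) ?subsetDl.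
  have d_gt1 : (1 < d)%N by rewrite -[1%N](exp1n 4) ltn_exp2r.
  have leMA : (d * M <= #|A1|)%N.
    apply: (leq_trans _ leAd); rewrite leq_mul2l; apply/orP; right.
    rewrite -[leqLHS]mul1n; apply: leq_trans (leq_mul y_gt0 (leqnn M)) _.
    by clear; lia.
  have := card_weak K' d_gt1 leMA N_gt0.
  move=> /(leq_trans (leq_mul (leqnn _) sbad)) {sbad} le_bad.
  rewrite -(ltn_pmul2r (fact_gt0 K'.*2)) -mulnA !bin_ffact.
  apply: leq_ltn_trans (leq_mul (leqnn _) (ffact_leq _ _)) _.
  apply: (leq_trans _ (leq_ffact _ (leqnn _))).
  rewrite -(@ltn_pmul2l (2 ^ K'.*2)) ?expn_gt0 // -expnMn.
  apply: (@leq_trans (N ^ K'.*2)); last by rewrite leq_exp2r // double_gt0.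
  rewrite -(@ltn_pmul2l (d ^ K')) ?expn_gt0 ?d_gt0 ?b_gt0 //.
  have -> : (d ^ K' * (2 ^ K'.*2 * (#|bad| * beta ^ K'.*2)) =
      d ^ K' * #|bad| * (2 ^ K'.*2 * beta ^ K'.*2))%N by clear; lia.
  apply: leq_ltn_trans (leq_mul le_bad (leqnn _)) _.
  have -> : (#|G| * (2 ^ K' * #|A1| ^ K'.*2) * (2 ^ K'.*2 * beta ^ K'.*2) =
     #|G| * (8 ^ K' * beta ^ K'.*2) * N ^ K'.*2)%N.
    have -> : (8 ^ K' = 2 ^ K' * 2 ^ K'.*2)%N by rewrite -expnD -[8%N]/(2 ^
      3)%N -expnM; congr (_ ^ _)%N; clear; lia.
    by rewrite -/N; clear; lia.
  rewrite ltn_pmul2r ?expn_gt0 ?N_gt0 //.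
  apply: (@leq_ltn_trans (beta ^ (W * W) * (beta ^ K' * beta ^ K'.*2))%N).
    apply: leq_mul => //; rewrite leq_mul2r leq_exp2r ?orbT //.
    by apply/orP; right; clear -leb; lia.
  rewrite /d -expnM -!expnD ltn_exp2l // /K' /half_block; clear; lia.
have [||X|A' [sA' cA'] noA'] := avoiding_subset _ _ _ few.
- by clear -leb; lia.
- have : (2 * beta <= N)%N.
    apply: (leq_trans _ leN); rewrite bW8.
    exact: leq_mul (leq_trans b_gt1 le_b_bW3) le_b_b5.
  by clear -leAs; lia.
- by rewrite inE => /and3P[-> /eqP-> _].
have sAsA1 : As \subset A1 by apply: subsetDl.
exists A1, A'; split=> //; first exact: subset_trans sA' sAsA1.
move=> xs S sxs sS leS.
apply: (absorb_many A10 c_gt0 d_gt0 spA _ leAm leAd sA' (K0 := K'.*2)) => //.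
  move=> X sX cX; apply/negP => wX; have := noA' X.
  by rewrite inE cX eqxx wX (subset_trans sX sA') sX => /(_ isT).
apply: (leq_trans _ leS); rewrite leq_mul2r leq_mul2r leq_double lek; lia.
Qed.

(** * Slice rank *)

Section Echelon.
Variables (F : fieldType) (L r : nat) (M : 'M[F]_(L, r)).

Definition tail_span (n : nat) : 'M[F]_r :=
  (\sum_(i < L | (n <= i)%N) <<row i M>>)%MS.

(* A row that is not a pivot is a combination of later rows, which gives a vector
   of the left kernel whose first nonzero coordinate is at that row. *)
Definition pivots : {set 'I_L} :=
  [set j | ~~ (row j M <= tail_span j.+1)%MS].

Lemma tail_spanS (j : 'I_L) :
  (tail_span j :=: <<row j M>> + tail_span j.+1)%MS.
Proof.
rewrite /tail_span (bigD1 j) //=.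
rewrite (eq_bigl (fun i : 'I_L => (j < i)%N)); first exact: eqmx_refl.
by move=> i; rewrite ltn_neqAle eq_sym andbC.
Qed.

(** Going up from the last row, each pivot raises the rank of the tail span. *)
Lemma card_pivots_rank n : (n <= L)%N ->
  (#|[set j in pivots | (n <= j)%N]| <= \rank (tail_span n))%N.
Proof.
move=> lenL; rewrite -(subKn lenL);
  elim: (L - n)%N (leq_subr n L) => [|d IHd] led.
  rewrite subn0; set Z := [set j in _ | _].
  suff -> : Z = set0 by rewrite cards0.
  by apply/setP => j; rewrite !inE leqNgt ltn_ord andbF.
have ltj : (L - d.+1 < L)%N by lia.
pose j := Ordinal ltj.
have eS : (L - d = j.+1)%N by rewrite /=; lia.
rewrite -[(L - d.+1)%N]/(nat_of_ord j); have := IHd (ltnW led);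
  rewrite eS => {}IHd.
have -> : [set i in pivots | (j <= i)%N] =
    (if j \in pivots then [set j] else set0) :|: [set i in pivots | (j < i)%N].
  move: pivots => P; apply/setP => i; rewrite in_setU !in_set leq_eqVlt.
  have [<-|neq] := eqVneq j i; first by rewrite eqxx ltnn andbT orbC;
    case: ifP; rewrite !inE ?eqxx.
  rewrite (inj_eq val_inj) (negbTE neq) /=.
  by case: ifP; rewrite inE // eq_sym (negbTE neq).
rewrite (tail_spanS j); case: ifPn => [|_].
  rewrite inE => npiv; apply: leq_trans (leq_card_setU _ _) _; rewrite cards1.
  apply: leq_ltn_trans IHd _; rewrite ltn_neqAle mxrankS ?addsmxSr // andbT.
  apply: contra npiv => /eqP erank;
    have : (tail_span j.+1 == <<row j M>> + tail_span j.+1)%MS.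
    by rewrite -(geq_leqif (mxrank_leqif_eq (addsmxSr _ _))) erank.
  case/andP => _; rewrite addsmx_sub genmxE => /andP[] //.
by rewrite set0U (leq_trans IHd) // mxrankS ?addsmxSr.
Qed.

Lemma card_pivots : (#|pivots| <= r)%N.
Proof.
have := card_pivots_rank (leq0n L).
have -> : [set j in pivots | (0 <= j)%N] = pivots.
  by apply/setP => j; rewrite !inE andbT.
by move=> /leq_trans; apply; rewrite rank_leq_col.
Qed.

Lemma dual_vector j : j \notin pivots ->
  exists2 phi : 'I_L -> F,
    phi j = 1 /\ (forall i : 'I_L, (i < j)%N -> phi i = 0) &
    forall c, \sum_i phi i * M i c = 0.
Proof.
rewrite inE negbK => /sub_sumsmxP[u eu].
have /choice[a ea] : forall i : 'I_L, exists a,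
  u i *m <<row i M>>%MS = a *: row i M.
  by move=> i; apply/sub_rVP; rewrite (submx_trans (submxMl _ _)) ?genmxE.
exists (fun i => if i == j then 1 else if (j < i)%N then - a i else 0).
  rewrite eqxx; split=> // i ltij; rewrite ltnNge ltnW //= ifF //.
  by apply/eqP => eij; rewrite eij ltnn in ltij.
move=> c; rewrite (bigD1 j) //= eqxx mul1r.
have := congr1 (fun A : 'rV_r => A 0 c) eu; rewrite !mxE summxE => ->.
rewrite (eq_bigr (fun i => a i * M i c)); last first.
  by move=> i _; rewrite ea !mxE.
rewrite [X in X + _]big_mkcond [X in X + _](bigD1 j) //= ltnn add0r -big_split
  /=.
apply: big1 => i neq; rewrite (negbTE neq); case: ifP => _.
  by rewrite mulNr subrr.
by rewrite mul0r addr0.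
Qed.
End Echelon.

Lemma sum_pow2_rev p : (\sum_(x < p) 2 ^ (p.-1 - x) <= 2 ^ p)%N.
Proof.
case: p => [|p]; first by rewrite big_ord0.
rewrite (reindex_inj rev_ord_inj) /= (eq_bigr (fun i : 'I_p.+1 => 2 ^ i)%N).
  elim: p.+1 => [|k IHk]; first by rewrite big_ord0.
  by rewrite big_ord_recr /= expnS mul2n -addnn leq_add2r.
by move=> i _; rewrite subSS subKn // -ltnS.
Qed.

(** Give [e] the weight 2^(-degree), scaled to be integral: the vectors counted have weight at least
    2^(-D), and all weights sum to a product of n geometric series, each at most 2. *)
Lemma card_low_degree n p D :
  (#|[set e : {ffun 'I_n -> 'I_p} | (\sum_c e c <= D)%N]| <= 2 ^ (D + n))%N.
Proof.
case: p => [|p].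
  apply: leq_trans (max_card _) _; rewrite card_ffun !card_ord.
  by case: n => [|n]; rewrite ?expn_gt0 ?exp0n.
set E := [set e | _].
rewrite -(@leq_pmul2r (2 ^ (n * p))) ?expn_gt0 // -sum_nat_const.
apply: (@leq_trans (\sum_(e in E) 2 ^ D * \prod_c 2 ^ (p - e c))%N).
  apply: leq_sum => e; rewrite inE => leD;
    rewrite -expn_sum -expnD leq_exp2l //.
  apply: leq_trans (_ : \sum_c e c + \sum_(c < n) (p - e c) <= _)%N.
    rewrite -big_split /= (eq_bigr (fun=> p)) ?sum_nat_const ?card_ord // =>
      c _.
    by rewrite subnKC // -ltnS.
  by rewrite leq_add2r.
rewrite -big_distrr /= expnD -mulnA leq_mul2l; apply/orP; right.
apply: (@leq_trans (\sum_(e : {ffun 'I_n -> 'I_p.+1}) \prod_c 2 ^ (p - e c))%N).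
  by rewrite [leqRHS](bigID (mem E)) /= leq_addr.
rewrite -(bigA_distr_bigA (fun (c : 'I_n) (x : 'I_p.+1) => 2 ^ (p - x))%N) /=.
rewrite prod_nat_const card_ord -expnD -mulnS mulnC expnM.
by case: n {E} => // n; rewrite leq_exp2r // (sum_pow2_rev p.+1).
Qed.

(** * The zero-sum indicator as a polynomial over F_p *)

Section Tensor.
Variables (p n h L : nat) (I : finType) (f : I -> 'I_L -> 'rV['F_p]_n).
Hypothesis p_pr : prime p.
Local Notation F := 'F_p.

Lemma Fp_indicator (x : F) : 1 - x ^+ p.-1 = (x == 0)%:R.
Proof.
have p1 : (0 < p.-1)%N by have := prime_gt1 p_pr; lia.
have [->|x0] := eqVneq x 0; first by rewrite expr0n eqn0Ngt p1 subr0.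
apply/eqP; rewrite subr_eq0 eq_sym; apply/eqP/(mulfI x0).
rewrite mulr1 -exprS prednK ?prime_gt0 //.
by have := expf_card x; rewrite card_Fp.
Qed.

Definition tensor (J : {ffun I -> 'I_L}) : F :=
  \prod_c (1 - (\sum_i f i (J i) 0 c) ^+ p.-1).

Lemma tensorE J : tensor J = (\sum_i f i (J i) == 0)%:R.
Proof.
rewrite /tensor (eq_bigr (fun c => ((\sum_i f i (J i)) 0 c == 0)%:R));
  last first.
  by move=> c _; rewrite Fp_indicator summxE.
have [->|] := eqVneq (\sum_i f i (J i)) 0.
  by rewrite big1 // => c _; rewrite mxE eqxx.
move=> neq; have [c /negbTE nc] : exists c, (\sum_i f i (J i)) 0 c != 0.
  apply/existsP; apply: contraNT neq; rewrite negb_exists => /forallP h0.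
  by apply/eqP/rowP => c; rewrite mxE; apply/eqP; rewrite -[_ == _]negbK h0.
by rewrite (bigD1 c) //= nc mul0r.
Qed.

(** A term in the expansion of 1 - (x_1 + .. )^(p - 1): [None] is the constant 1, and [Some w] takes
    the variable [w l] from the l-th factor. *)
Local Notation word := (option {ffun 'I_p.-1 -> I}).
Definition degree (g : word) (i : I) : nat :=
  if g is Some w then #|[set l | w l == i]| else 0.
Definition wsign (g : word) : F := if g is Some _ then -1 else 1.

Lemma degree_lt g i : (degree g i < p)%N.
Proof.
rewrite -[ltnRHS](prednK (prime_gt0 p_pr)) ltnS.
case: g => [w|] //=; apply: leq_trans (max_card _) _; by rewrite card_ord.
Qed.

Lemma sum_degree g : (\sum_i degree g i <= p.-1)%N.
Proof.
case: g => [w|] /=; last by rewrite big1.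
rewrite (eq_bigr (fun i => \sum_(l | w l == i) 1)%N); last first.
  by move=> i _; rewrite -sum1_card; apply: eq_bigl => l; rewrite inE.
apply: (@leq_trans (\sum_(l < p.-1) 1)%N); last by rewrite sum1_card card_ord.
by rewrite (partition_big w predT).
Qed.

Lemma tensor_expand J : tensor J =
  \sum_(g : {ffun 'I_n -> word})
     (\prod_c wsign (g c)) * \prod_i \prod_c f i (J i) 0 c ^+ degree (g c) i.
Proof.
transitivity (\prod_(c < n) \sum_(g : word)
    (wsign g * \prod_i f i (J i) 0 c ^+ degree g i)).
  apply: eq_bigr => c _; rewrite (bigD1 None) //= mul1r; congr (_ + _).
    by rewrite big1 // => i _; rewrite expr0.
  rewrite (reindex_omap (some : _ -> word) id) /=; last by case.
  rewrite -[in LHS](card_ord p.-1) -prodr_const bigA_distr_bigA /= -sumrN.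
  apply: eq_big => [w|w _]; first by rewrite eqxx.
  rewrite mulN1r; congr (- _).
  rewrite (partition_big w predT) //=; apply: eq_bigr => i _.
  rewrite (eq_bigr (fun=> f i (J i) 0 c)) => [|l /eqP<- //].
  by rewrite prodr_const; congr (_ ^+ _); apply: eq_card => l; rewrite !inE.
rewrite bigA_distr_bigA /=; apply: eq_bigr => g _.
by rewrite big_split /=; congr (_ * _); rewrite exchange_big.
Qed.

Hypothesis leph : (p <= #|I| * h)%N.

(** A monomial has degree at most n (p - 1) < |I| (n h + 1), so its degree in some variable i is at
    most n h, and the sum over J i vanishes. *)
Lemma tensor_orthogonal (phi : I -> 'I_L -> F) :
  (forall i (e : {ffun 'I_n -> 'I_p}), (\sum_c e c <= n * h)%N ->
     \sum_j phi i j * \prod_c f i j 0 c ^+ e c = 0) ->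
  \sum_(J : {ffun I -> 'I_L}) tensor J * \prod_i phi i (J i) = 0.
Proof.
move=> orth.
rewrite (eq_bigr (fun J : {ffun I -> 'I_L} => \sum_(g : {ffun 'I_n -> word})
   (\prod_c wsign (g c)) *
   \prod_i (phi i (J i) * \prod_c f i (J i) 0 c ^+ degree (g c) i)));
     last first.
  move=> J _; rewrite tensor_expand mulr_suml; apply: eq_bigr => g _.
  by rewrite -mulrA big_split /= [X in _ * X]mulrC.
rewrite exchange_big big1 //= => g _; rewrite -mulr_sumr.
rewrite -(bigA_distr_bigA (fun i j =>
  phi i j * \prod_c f i j 0 c ^+ degree (g c) i)) /=.
have [i low] : exists i, (\sum_c degree (g c) i <= n * h)%N.
  apply/existsP; rewrite -[X in is_true X]negbK negb_exists;
    apply/negP => /forallP hi.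
  have : (\sum_(i : I) (n * h).+1 <= \sum_i \sum_c degree (g c) i)%N.
    by apply: leq_sum => i _; rewrite ltnNge.
  rewrite exchange_big sum_nat_const (@eq_card _ _ I) // leqNgt => /negP; apply.
  apply: (@leq_ltn_trans (n * p.-1)%N).
    rewrite -[n in leqRHS]card_ord -sum_nat_const; apply: leq_sum => c _.
    exact: sum_degree.
  have := prime_gt0 p_pr; have := leph; rewrite mulnS mulnCA => le1 p0.
  have : (n * p <= n * (#|I| * h))%N by rewrite leq_mul2l le1 orbT.
  have I0 : (0 < #|I|)%N by case: #|I| le1 => //; rewrite mul0n; lia.
  have : (n * p.-1 <= n * p)%N by rewrite leq_mul2l leq_pred orbT.
  by move=> le2 le3; rewrite -add1n; apply: leq_add I0 (leq_trans le2 le3).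
rewrite (bigD1 i) //=.
rewrite (_ : \sum_j phi i j * _ = 0) ?mul0r ?mulr0 //.
have := orth i [ffun c => Ordinal (degree_lt (g c) i)].
rewrite (eq_bigr (fun c => degree (g c) i)) => [/(_ low) e0|c _];
  last by rewrite ffunE.
rewrite -[RHS]e0; by apply: eq_bigr => j _; congr (_ * _);
  apply: eq_bigr => c _; rewrite ffunE.
Qed.
End Tensor.

(** * Dual functions and the slice rank argument *)

Section Slicing.
Variables (p n h L : nat) (I : finType) (f : I -> 'I_L -> 'rV['F_p]_n).
Hypotheses (p_pr : prime p) (leph : (p <= #|I| * h)%N).

(** The rows of [M] evaluate the monomials of degree at most n h at the points g j, so left kernel
    vectors annihilate these monomials; [S] is the set of pivots. *)
Lemma dual_function (g : 'I_L -> 'rV['F_p]_n) :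
  exists S : {set 'I_L}, (#|S| <= 2 ^ (n * h + n))%N /\
  forall j, j \notin S -> exists2 phi : 'I_L -> 'F_p,
    phi j = 1 /\ (forall i : 'I_L, (i < j)%N -> phi i = 0) &
    forall e : {ffun 'I_n -> 'I_p}, (\sum_c e c <= n * h)%N ->
      \sum_i phi i * \prod_c g i 0 c ^+ e c = 0.
Proof.
set E := [set e : {ffun 'I_n -> 'I_p} | (\sum_c e c <= n * h)%N].
pose M := \matrix_(j < L, e < #|E|) \prod_c g j 0 c ^+ (enum_val e) c.
exists (pivots M); split; first exact: leq_trans (card_pivots M)
  (card_low_degree _ _ _).
move=> j /dual_vector[phi phiP orth]; exists phi => // e le.
have eE : e \in E by rewrite inE.
have := orth (enum_rank_in eE e); move=> e0; rewrite -[RHS]e0.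
by apply: eq_bigr => i _; rewrite mxE enum_rankK_in.
Qed.

Lemma dual_function_rev (g : 'I_L -> 'rV['F_p]_n) (up : bool) :
  exists S : {set 'I_L}, (#|S| <= 2 ^ (n * h + n))%N /\
  forall j, j \notin S -> exists2 phi : 'I_L -> 'F_p,
    phi j = 1 /\
      (forall i : 'I_L, (if up then i < j else j < i)%N -> phi i = 0) &
    forall e : {ffun 'I_n -> 'I_p}, (\sum_c e c <= n * h)%N ->
      \sum_i phi i * \prod_c g i 0 c ^+ e c = 0.
Proof.
case: up; first exact: dual_function.
have [S [leS SP]] := dual_function (g \o @rev_ord L).
exists [set j | rev_ord j \in S]; split.
  rewrite -(card_imset _ rev_ord_inj); apply: leq_trans leS.
  by apply/subset_leq_card/subsetP => _ /imsetP[j + ->]; rewrite inE.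
move=> j; rewrite inE => /SP[phi [phi1 phi0] orth].
exists (phi \o @rev_ord L).
  split=> // i ltji; apply: phi0 => /=; have := ltn_ord i; lia.
move=> e /orth; rewrite (reindex_inj rev_ord_inj) /= => e0; rewrite -[RHS]e0.
by apply: eq_bigr => i _; rewrite rev_ordK.
Qed.

(* Some [j] is a pivot for no slice.  If (j, .., j) were the only point of the
   tensor's support in the orthant given by [up],
     pairing the tensor with the dual
   vectors at [j] would give 1; but every monomial of the tensor has low degree
   in some variable, so the pairing is 0. *)
Lemma slice_rank (up : I -> bool) :
  (#|I| * 2 ^ (n * h + n) < L)%N -> (forall j, \sum_i f i j = 0) ->
  exists (j : 'I_L) (J : {ffun I -> 'I_L}),
    [/\ \sum_i f i (J i) = 0, exists i, J i != j &
        forall i, if up i then (j <= J i)%N else (J i <= j)%N].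
Proof.
move=> ltL diag.
have /choice[S SP] := fun i => dual_function_rev (f i) (up i).
have [j jS] : exists j, j \notin \bigcup_i S i.
  apply/existsP; rewrite -negb_forall; apply: contraL ltL => /forallP all_in.
  rewrite -leqNgt -[L in leqLHS]card_ord.
  apply: leq_trans (_ : #|\bigcup_i S i| <= _)%N.
    by apply/subset_leq_card/subsetP => j _; apply: all_in.
  apply: leq_trans (leq_card_bigcup _ _) _.
  rewrite -sum_nat_const; apply: leq_sum => i _; exact: (SP i).1.
have /choice[phi phiP] : forall i, exists phi : 'I_L -> 'F_p, phi j = 1 /\
    (forall l : 'I_L, (if up i then l < j else j < l)%N -> phi l = 0) /\
    (forall e : {ffun 'I_n -> 'I_p}, (\sum_c e c <= n * h)%N ->
      \sum_l phi l * \prod_c f i l 0 c ^+ e c = 0).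
  move=> i; have jSi : j \notin S i.
    by apply: contra jS => jSi; apply/bigcupP; exists i.
  by have [phi [phi1 phi0] orth] := (SP i).2 j jSi; exists phi.
have [/existsP[J /and3P[/eqP sJ /existsP[i nJ] /forallP ord]]|] := boolP
  [exists J : {ffun I -> 'I_L}, [&& \sum_i f i (J i) == 0, [exists i,
    J i != j] &
     [forall i, if up i then (j <= J i)%N else (J i <= j)%N]]].
  by exists j, J; split=> //; exists i.
rewrite negb_exists => /forallP none.
have := tensor_orthogonal p_pr leph (fun i => (phiP i).2.2).
rewrite (bigD1 [ffun=> j]) //= tensorE // [X in _ + X]big1 => [|J neq].
  rewrite [X in _ * X]big1 ?mulr1 ?addr0 => [|i _];
    last by rewrite ffunE (phiP i).1.
  rewrite (eq_bigr (fun i => f i j)) => [|i _]; last by rewrite ffunE.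
  by rewrite diag eqxx => /eqP; rewrite oner_eq0.
have := none J; rewrite tensorE //; case: eqP => [_|_ _]; last by rewrite mul0r.
have -> /= : [exists i, J i != j].
  apply: contraR neq; rewrite negb_exists => /forallP eqj.
  by apply/eqP/ffunP => i; rewrite ffunE; apply/eqP; rewrite -[_ == _]negbK eqj.
rewrite negb_forall => /existsP[i ni].
rewrite (bigD1 i) //= (phiP i).2.1 ?mul0r ?mulr0 //.
by move: ni; case: (up i); rewrite -ltnNge.
Qed.
End Slicing.

(** * Zero-sum tuples with few repetitions *)

Section Pattern.
Variables (p : nat) (T : finType).
Implicit Types u v : {ffun 'I_p -> T}.

(** Sends a position to a representative of its class of equal entries, and so encodes the partition
    into classes. *)
Definition pattern u : {ffun 'I_p -> 'I_p} :=
  [ffun i => odflt i [pick j | u j == u i]].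

Definition values u : {set T} := [set u i | i : 'I_p].

Definition repeated (k : {ffun 'I_p -> 'I_p}) : {set 'I_p} :=
  [set i | [exists j, (j != i) && (k j == k i)]].

Lemma mem_values u i : u i \in values u.
Proof. exact: imset_f. Qed.

Lemma patternK u i : u (pattern u i) = u i.
Proof.
by rewrite ffunE; case: pickP => [j /eqP //|/(_ i)]; rewrite eqxx.
Qed.

Lemma pattern_eq u i j : (pattern u i == pattern u j) = (u i == u j).
Proof.
apply/eqP/eqP => [e|e]; first by rewrite -(patternK u i) e patternK.
rewrite !ffunE e; case: pickP => // /(_ j); by rewrite eqxx.
Qed.

Lemma pattern_idem u i : pattern u (pattern u i) = pattern u i.
Proof. by apply/eqP; rewrite pattern_eq patternK. Qed.

Lemma card_image_pattern u : #|[set pattern u i | i : 'I_p]| = #|values u|.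
Proof.
have -> : values u = u @: [set pattern u i | i : 'I_p].
  apply/setP => x; apply/imsetP/imsetP => [[i _ ->]|[_ /imsetP[i _ ->] ->]].
    by exists (pattern u i); rewrite ?imset_f ?patternK.
  by exists (pattern u i).
rewrite [RHS]card_in_imset // => _ _ /imsetP[i _ ->] /imsetP[j _ ->].
by rewrite !patternK => /eqP; rewrite -pattern_eq => /eqP.
Qed.

Lemma card_values_le u : (#|values u| <= p)%N.
Proof. by rewrite -[leqRHS]card_ord;
  apply: leq_trans (leq_imset_card _ _) _. Qed.

End Pattern.

(** * Splitting classes of equal entries *)

Section Split.
Variables (p n h : nat).
Hypothesis p_pr : prime p.
Local Notation G := 'rV['F_p]_n.
Local Notation tuple := {ffun 'I_p -> G}.
Implicit Types (u v : tuple) (UU VV : {set tuple}).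

(* One tensor variable for each repeated position; the entries at the other
   positions are added to the variable of [i0].  In each class of equal entries
   the first position is ordered upwards and the others downwards, so that a
   support point above the diagonal point [j] which does not split any class is
   equal to it. *)
Lemma split_columns (k : {ffun 'I_p -> 'I_p}) (L : nat) (U : 'I_L -> tuple) :
  (forall j, pattern (U j) = k) ->
  (forall j j', j != j' -> [disjoint values (U j) & values (U j')]) ->
  (forall j, \sum_i U j i = 0) ->
  (p <= #|repeated k| * h)%N -> (p * 2 ^ (n * h + n) < L)%N ->
  exists u : tuple, [/\ \sum_i u i = 0, (forall i, exists j, u i = U j i) &
    (#|[set k i | i : 'I_p]| < #|values u|)%N].
Proof.
move=> patU dU sumU leD ltL.
have p_gt0 := prime_gt0 p_pr.
have L_gt0 : (0 < L)%N by apply: leq_ltn_trans ltL.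
have kU j i i' : (k i == k i') = (U j i == U j i') by rewrite -(patU j)
  pattern_eq.
have kK i : k (k i) = k i by rewrite -(patU (Ordinal L_gt0)) pattern_idem.
pose D := repeated k; pose I : finType := {i | i \in D}.
have D_gt0 : (0 < #|D|)%N by rewrite lt0n; apply: contraTneq leD => ->;
  rewrite -ltnNge.
have [d0 d0D] : exists i, i \in D by apply/card_gt0P.
pose i0 : I := exist _ d0 d0D.
have kD i : i \in D -> k i \in D.
  move=> iD; have [->//|nki] := eqVneq (k i) i; rewrite inE.
  by apply/existsP; exists i; rewrite eq_sym nki kK eqxx.
pose f (i : I) (j : 'I_L) : G :=
  U j (val i) + (if i == i0 then \sum_(l | l \notin D) U j l else 0).
have sumf (J : I -> 'I_L) : \sum_i f i (J i) =
    \sum_(i : I) U (J i) (val i) + \sum_(l | l \notin D) U (J i0) l.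
  rewrite big_split /=; congr (_ + _).
  by rewrite (bigD1 i0) //= eqxx [X in _ + X]big1 ?addr0 // => i /negbTE->.
have sumD (g : 'I_p -> G) : \sum_(i : I) g (val i) = \sum_(i in D) g i.
  rewrite [RHS](reindex_omap (val : I -> 'I_p) insub) /=.
    by apply: eq_bigl => i; rewrite valK (valP i) eqxx.
  by move=> i iD; rewrite insubT.
have cardI : #|I| = #|D| by rewrite card_sig; apply: eq_card => i; rewrite !inE.
have [|||j [J [sJ [i1 nJ] ord]]] :=
  @slice_rank p n h L I f p_pr _ (fun i => k (val i) == val i).
- by rewrite cardI.
- apply: leq_ltn_trans ltL; rewrite leq_mul2r cardI -[p in leqRHS]card_ord
  max_card.
  by rewrite orbT.
- move=> j; rewrite (sumf (fun=> j)) (sumD (fun i => U j i)) -[RHS](sumU j).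
  by rewrite [RHS](bigID (mem D)).
pose jj i := if insub i is Some i' then J (i' : I) else J i0.
have jjD (i : I) : jj (val i) = J i by rewrite /jj valK.
have jjN i : i \notin D -> jj i = J i0 by move=> niD; rewrite /jj insubN.
pose u : tuple := [ffun i => U (jj i) i].
have u_eq i i' : u i = u i' -> jj i = jj i' /\ k i = k i'.
  rewrite !ffunE => e; have ejj : jj i = jj i'.
    apply/eqP; apply: contraT => /dU /disjointFr/(_ (mem_values _ i)).
    by rewrite e mem_values.
  by split=> //; apply/eqP; rewrite (kU (jj i)) e ejj.
exists u; split.
- rewrite (bigID (mem D)) /= -(sumD (fun i => u i)) -[RHS]sJ sumf;
  congr (_ + _).
    by apply: eq_bigr => i _; rewrite ffunE jjD.
  by apply: eq_bigr => l nl; rewrite ffunE jjN.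
- by move=> i; exists (jj i); rewrite ffunE.
(* If the columns were constant on classes, the upward order at the representative and the downward
   order at another member would force J = j. *)
have [i /andP[iD nji]] : exists i, (i \in D) && (jj i != jj (k i)).
  apply/existsP; apply: contraR nJ; rewrite negb_exists => /forallP all_eq.
  have eqJ (i : I) : jj (val i) = jj (k (val i)).
    by have := all_eq (val i); rewrite (valP i) /= negbK => /eqP.
  pose ki : I := exist _ (k (val i1)) (kD _ (valP i1)).
  have := ord ki; rewrite /= kK eqxx -jjD => le1.
  have [i' /andP[ni' ki']] : exists i',
    (i' != k (val i1)) && (k i' == k (val i1)).
    have := kD _ (valP i1); rewrite inE => /existsP[i' /andP[ni' ki']].
    by exists i'; rewrite ni' -[eqbRHS]kK.
  have i'D : i' \in D.
    rewrite inE; apply/existsP; exists (k (val i1)).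
    by rewrite eq_sym ni' kK eq_sym.
  have := ord (exist _ i' i'D); rewrite /= ifN;
    last by rewrite (eqP ki') eq_sym.
  rewrite -jjD (eqJ (exist _ i' i'D)) /= (eqP ki') => le2.
  rewrite -jjD eqJ; apply/eqP/val_inj/eqP.
  by rewrite eqn_leq le2 le1.
(* Representatives of distinct classes keep distinct entries, and a split class contributes the
   extra value u i. *)
apply: (@leq_ltn_trans #|u @: [set k i | i : 'I_p]|).
  rewrite card_in_imset // => _ _ /imsetP[i2 _ ->] /imsetP[i3 _ ->].
  by move=> /u_eq[_]; rewrite !kK.
apply: proper_card; apply/properP; split.
  by apply/subsetP => _ /imsetP[i2 _ ->]; apply: imset_f.
exists (u i); first exact: imset_f.
apply/imsetP => -[_ /imsetP[i2 _ ->] /u_eq[ejj]]; rewrite kK => ek.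
by move: nji; rewrite ek -ejj eqxx.
Qed.

Definition packing UU :=
  {in UU &, forall u v, u != v -> [disjoint values u & values v]}.
Definition zero_sums UU := forall u, u \in UU -> \sum_i u i = 0.

Local Notation bound := (p * 2 ^ (n * h + n)).+1.

(** Greedy: a split tuple draws its entries from at most p members of [UU]; discarding these keeps
    later tuples disjoint from it and leaves enough for the next round. *)
Lemma split_packing (k : {ffun 'I_p -> 'I_p}) (s : nat) UU :
  (forall u, u \in UU -> pattern u = k) -> packing UU -> zero_sums UU ->
  (p <= #|repeated k| * h)%N -> (s * p + bound <= #|UU|)%N ->
  exists VV, [/\ #|VV| = s, packing VV, zero_sums VV,
    (forall v i, v \in VV -> exists2 u, u \in UU & v i \in values u) &
    (forall v, v \in VV -> #|[set k i | i : 'I_p]| < #|values v|)%N].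
Proof.
move=> + + + leD; elim: s UU => [|s IHs] UU patU packU sumU leU.
  by exists set0; rewrite cards0; split=> // [u v|u|v i|v]; rewrite inE.
have ltU : (p * 2 ^ (n * h + n) < #|UU|)%N by apply: leq_trans leU;
  rewrite leq_addl.
have [|||v [sv vU ltv]] :=
    @split_columns k #|UU| (fun j => enum_val j) _ _ _ leD ltU.
- by move=> j; apply: patU; apply: enum_valP.
- move=> j j' njj'; apply: packU; rewrite ?enum_valP //.
  by rewrite (inj_eq enum_val_inj).
- by move=> j; apply: sumU; apply: enum_valP.
have vU' i : exists u, u \in UU /\ v i \in values u.
  have [j ->] := vU i; exists (enum_val j).
  by rewrite enum_valP mem_values.
have /choice[w wP] := vU'.
pose W := [set w i | i : 'I_p].
have leW : (#|W| <= p)%N by rewrite -[leqRHS]card_ord;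
  apply: leq_trans (leq_imset_card _ _) _.
have sWU : W \subset UU by apply/subsetP => _ /imsetP[i _ ->]; case: (wP i).
have [||||VV [cV packV sumV VU ltV]] := IHs (UU :\: W).
- by move=> u /setDP[uU _]; apply: patU.
- by move=> u u' /setDP[uU _] /setDP[u'U _]; apply: packU.
- by move=> u /setDP[uU _]; apply: sumU.
- rewrite cardsD (setIidPr sWU); apply: leq_trans (leq_sub2l _ leW).
  rewrite leq_psubRL; first by rewrite addnA -mulSn.
  by rewrite addnS.
have dvV v' : v' \in VV -> [disjoint values v & values v'].
  move=> v'V; rewrite -setI_eq0; apply/eqP/setP => x; rewrite !inE.
  apply/negP => /andP[/imsetP[i _ ->] /imsetP[i' _ e]].
  have [u /setDP[uU uW] xu] := VU v' i' v'V.
  have [wU wi] := wP i; have nuw : w i != u.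
    by apply: contraNneq uW => <-; apply: imset_f.
  by have := disjointFr (packU _ _ wU uU nuw) wi; rewrite e xu.
have nvV : v \notin VV.
  apply/negP => /dvV; rewrite -setI_eq0 setIid => /eqP v0.
  by have := mem_values v (Ordinal (prime_gt0 p_pr)); rewrite v0 inE.
exists (v |: VV); split.
- by rewrite cardsU1 nvV cV.
- move=> u u' /setU1P[->|uV] /setU1P[->|u'V] nuu'.
  + by rewrite eqxx in nuu'.
  + exact: dvV.
  + by rewrite disjoint_sym; apply: dvV.
  + exact: packV.
- by move=> u /setU1P[->//|]; apply: sumV.
- move=> u i /setU1P[->|uV]; first by have [wU wi] := wP i; exists (w i).
  by have [u' /setDP[u'U _] ?] := VU u i uV; exists u'.
- by move=> u /setU1P[->//|]; apply: ltV.
Qed.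

Lemma same_pattern UU c : (p ^ p * c <= #|UU|)%N -> UU != set0 ->
  exists k, (c <= #|[set u in UU | pattern u == k]|)%N.
Proof.
move=> leU /set0Pn[u0 u0U]; apply/existsP; apply: contraLR leU.
rewrite negb_exists => /forallP ltc; rewrite -ltnNge.
have sU : UU \subset \bigcup_(k in [set: {ffun 'I_p ->
  'I_p}]) [set u in UU | pattern u == k].
  by apply/subsetP => u uU; apply/bigcupP; exists (pattern u);
    rewrite !inE // uU eqxx.
have c_gt0 : (0 < c)%N by have := ltc (pattern u0); rewrite -ltnNge; case: (c).
have leU : (#|UU| <= p ^ p * c.-1)%N.
  apply: leq_trans (subset_leq_card sU) _.
  apply: leq_trans (leq_card_bigcup_const (c := c.-1) _) _.
    by move=> k _; have := ltc k; rewrite -ltnNge; case: (c) c_gt0.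
  by rewrite cardsT card_ffun !card_ord.
by apply: leq_ltn_trans leU _; rewrite ltn_pmul2l ?prednK // expn_gt0
  (prime_gt0 p_pr).
Qed.

(** Disjoint tuples needed with t rounds to go: p^p for a common pattern, p for each new tuple, and
    [bound] for splitting. *)
Fixpoint supply (t : nat) : nat :=
  if t is t'.+1 then p ^ p * (supply t' * p + bound) else 1.

Lemma supply_bound t :
  (supply t <= (p ^ p * p.+1) ^ t * bound)%N.
Proof.
elim: t => [|t IHt]; first by rewrite expn0 mul1n.
rewrite expnS /= -!mulnA leq_mul2l; apply/orP; right.
apply: (@leq_trans (((p ^ p * p.+1) ^ t * bound) * p + (p ^ p * p.+1) ^ t *
  bound)%N).
  rewrite leq_add ?leq_mul2r ?IHt ?orbT // leq_pmull //.
  by rewrite expn_gt0 muln_gt0 expn_gt0 (prime_gt0 p_pr).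
by rewrite addnC [(_ * p)%N]mulnC -mulSn.
Qed.

(** Start from constant tuples. If all zero-sum tuples over [A] had many repetitions, every round of
    fixing a pattern and splitting would raise the number of distinct entries, beyond p in the
    end. *)
Lemma mostly_distinct_zero_sum (A : {set G}) : (supply p <= #|A|)%N ->
  exists u : tuple, [/\ \sum_i u i = 0, (forall i, u i \in A) &
    (#|repeated (pattern u)| * h < p)%N].
Proof.
move=> leA; apply: contrapT => none.
have p_gt0 := prime_gt0 p_pr.
have big u : \sum_i u i = 0 -> (forall i, u i \in A) ->
    (p <= #|repeated (pattern u)| * h)%N.
  by move=> su uA; rewrite leqNgt; apply/negP => ltu; apply: none; exists u.
have go t : (t <= p)%N -> exists UU, [/\ (supply (p - t) <= #|UU|)%N,
  packing UU,
    zero_sums UU, (forall u i, u \in UU -> u i \in A) &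
    (forall u, u \in UU -> t < #|values u|)%N].
  elim: t => [|t IHt] letp.
    pose cst (a : G) : tuple := [ffun=> a].
    have cst_inj : injective cst.
      by move=> a a' /ffunP/(_ (Ordinal p_gt0)); rewrite !ffunE.
    have vcst a : values (cst a) = [set a].
      apply/setP => x; rewrite inE; apply/imsetP/eqP => [[i _ ->]|->].
        by rewrite ffunE.
      by exists (Ordinal p_gt0); rewrite ?ffunE.
    exists (cst @: A); split.
    - by rewrite subn0 card_imset.
    - move=> _ _ /imsetP[a aA ->] /imsetP[a' a'A ->] neq.
      rewrite !vcst disjoints1 inE; apply: contraNneq neq => -> //.
    - move=> _ /imsetP[a aA ->]; rewrite (eq_bigr (fun=> a)); last first.
        by move=> i _; rewrite ffunE.
      rewrite sumr_const card_ord; apply/rowP => c.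
      rewrite mulmxnE mxE -mulr_natr.
      by rewrite (pchar_Fp_0 p_pr) mulr0.
    - by move=> _ i /imsetP[a aA ->]; rewrite ffunE.
    - by move=> _ /imsetP[a aA ->]; rewrite vcst cards1.
  have [UU [leU packU sumU UA ltU]] := IHt (ltnW letp).
  move: leU; rewrite -subnSK //.
  move=> /= leU.
  have U0 : UU != set0.
    by rewrite -card_gt0 (leq_trans _ leU) // muln_gt0 expn_gt0 p_gt0 addnS.
  have [k lek] := same_pattern leU U0.
  set Uk := [set u in UU | _] in lek.
  have Uk_sub u : u \in Uk -> u \in UU by rewrite inE => /andP[].
  have Uk_pat u : u \in Uk -> pattern u = k by rewrite inE => /andP[_ /eqP].
  have [u0 u0k] : exists u, u \in Uk.
    by apply/set0Pn; rewrite -card_gt0; apply: leq_trans lek; rewrite addnS.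
  have lek' : (p <= #|repeated k| * h)%N.
    by rewrite -(Uk_pat _ u0k); apply: big; [apply: sumU|move=> i; apply: UA];
      apply: Uk_sub.
  have [||VV [cV packV sumV VU ltV]] := split_packing Uk_pat _ _ lek' lek.
  - by move=> u u' /Uk_sub uU /Uk_sub u'U; apply: packU.
  - by move=> u /Uk_sub; apply: sumU.
  exists VV; split=> //; first by rewrite cV.
    move=> v i vV; have [u /Uk_sub uU /imsetP[i' _ ->]] := VU v i vV.
    exact: UA.
  move=> v /ltV; apply: leq_trans;
    rewrite ltnS -(Uk_pat _ u0k) card_image_pattern.
  by apply: ltU; apply: Uk_sub.
have [UU [+ _ _ _ ltU]] := go p (leqnn p); rewrite subnn /= => /card_gt0P[u uU].
by have := leq_trans (ltU u uU) (card_values_le u); rewrite ltnn.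
Qed.
End Split.

(** * Reduction to prime moduli *)

(** Distinct entries used to absorb one repeated entry, plus one for that entry itself. *)
Definition ratio (W : nat) : nat :=
  ((max_reach W).*2 * (half_block W).*2).+1.

(** The power of 2 makes b^n at least [supply] for large n: the slice rank bound takes 2^(n (ratio +
    1)) and the factors depending on p take 2^n. The rest is the requirement of
    [exists_absorbing]. *)
Definition min_base (W : nat) : nat :=
  (2 ^ (ratio W + 2) + (8 * max_reach W + (half_block W).*2 + 8))%N.

Lemma setsum_imset (G : finZmodType) (I : finType) (u : I -> G) (D : {set I}) :
  {in D &, injective u} -> setsum (u @: D) = \sum_(i in D) u i.
Proof. exact: big_imset. Qed.

(** With beta = b^n and M = p, find a zero-sum tuple with few repetitions over the sampled set,
    absorb its repeated entries using the distinct ones, and realise the resulting robust sum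
    disjointly from the entries left over. *)
Lemma exists_distinct_zero_sum (W p b : nat) :
  (0 < W)%N -> prime p -> (min_base W <= b)%N -> (p <= b ^ (W * W))%N ->
  exists n0, forall n (A : {set 'rV['F_p]_n}), (n0 <= n)%N ->
    ((b ^ n) ^ (6 * W + 13) <= #|A|)%N ->
    exists X : {set 'rV['F_p]_n}, [/\ X \subset A, #|X| = p & setsum X = 0].
Proof.
move=> W_gt0 p_pr leb lep; have p_gt0 := prime_gt0 p_pr.
pose Q := ((p ^ p * p.+1) ^ p)%N.
have Q_gt0 : (0 < Q)%N by rewrite expn_gt0 muln_gt0 expn_gt0 p_gt0.
exists (Q * (2 * p))%N => n A len leA.
have leQ2 : (Q * (2 * p) <= 2 ^ n)%N by apply: leq_trans len (ltnW (ltn_expl _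
  _)).
have n_gt0 : (0 < n)%N by apply: leq_trans len; rewrite !muln_gt0 Q_gt0.
pose beta := (b ^ n)%N; set h := ratio W.
have b_gt1 : (1 < b)%N by move: leb; rewrite /min_base; clear; lia.
have le_bbeta : (b <= beta)%N by rewrite -[leqLHS]expn1 leq_exp2l.
have le2b : (2 ^ n <= beta)%N by rewrite leq_exp2r.
have lebeta : (8 * max_reach W + (half_block W).*2 + 8 <= beta)%N.
  by apply: leq_trans le_bbeta; apply: leq_trans leb; rewrite leq_addl.
have leM : (p <= beta)%N.
  apply: leq_trans le2b; apply: leq_trans leQ2.
  by rewrite mulnA -[leqLHS]mul1n leq_mul2r muln_gt0 Q_gt0 orbT.
have leG : (#|'rV['F_p]_n| <= beta ^ (W * W))%N.
  by rewrite card_mx card_Fp // mul1n /beta -expnM mulnC expnM leq_exp2r.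
have leS : (supply p n h p <= beta)%N.
  apply: leq_trans (supply_bound n h p_pr p) _; rewrite -/Q.
  apply: (@leq_trans (Q * (2 * p) * 2 ^ (n * h + n))%N).
    rewrite -!mulnA leq_mul2l; apply/orP; right.
    have : (0 < p * 2 ^ (n * h + n))%N by rewrite muln_gt0 p_gt0 expn_gt0.
    by clear; lia.
  apply: leq_trans (leq_mul leQ2 (leqnn _)) _; rewrite -expnD.
  apply: (@leq_trans ((2 ^ (h + 2)) ^ n)%N).
    by rewrite -expnM leq_exp2l //; clear; lia.
  by rewrite leq_exp2r //; apply: leq_trans leb; rewrite leq_addr.
have [A1 [A' [sA1 sA' cA' absA']]] := exists_absorbing W_gt0 lebeta leM leG leA.
have [|u [su uA' few]] := mostly_distinct_zero_sum p_pr (n := n) (h :=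
  h) (A := A').
  by rewrite cA'.
set D := repeated (pattern u) in few.
have inj : {in ~: D &, injective u}.
  move=> i j; rewrite in_setC => iD _ e; apply: contraNeq iD => nij.
  by rewrite inE; apply/existsP; exists j; rewrite eq_sym nij pattern_eq e /=.
pose xs := [seq u i | i <- enum D]; pose S := u @: ~: D.
have cS : (#|D| + #|S| = p)%N by rewrite card_in_imset // cardsC card_ord.
have size_xs : size xs = #|D| by rewrite size_map cardE.
have [|||S' [R [v [sS' rob cSS' eSS']]]] := absA' xs S.
- by move=> _ /mapP[i _ ->].
- by apply/subsetP => _ /imsetP[i _ ->].
- by move: few; rewrite -[ltnRHS]cS /h /ratio mulnS ltn_add2l mulnC size_xs =>
  /ltnW.
have sumS : v + setsum S' = 0.
  rewrite eSS' /xs big_map big_enum /= setsum_imset // -[RHS]su.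
  by rewrite [RHS](bigID (mem D)) /=; congr (_ + _); apply: eq_bigl => i;
    rewrite inE.
have [|X [sX dX cX eX]] := robustP (F := S') rob.
  by rewrite addnC cSS' size_xs cS.
exists (X :|: S'); split.
- rewrite subUset (subset_trans sX sA1) /=.
  apply: subset_trans sS' (subset_trans _ (subset_trans sA' sA1)).
  by apply/subsetP => _ /imsetP[i _ ->].
- by rewrite cardsU_disjoint // cX cSS' size_xs cS.
- by rewrite setsumU // eX.
Qed.

(* Vectors over the integers modulo [m] are represented by vectors of naturals,
   so that divisors of [m] can be treated without changing the group. *)
Definition zero_sum_forcing (m n s : nat) :=
  forall (T : finType) (f : T -> 'I_n -> nat), (s <= #|T|)%N ->
  exists I : {set T}, #|I| = m /\ forall c, (m %| \sum_(i in I) f i c)%N.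

Lemma zero_sum_forcing_sub m n s (T : finType) (U : {set T}) (f : T -> 'I_n ->
  nat) :
  zero_sum_forcing m n s -> (s <= #|U|)%N ->
  exists2 I : {set T}, I \subset U &
    #|I| = m /\ forall c, (m %| \sum_(i in I) f i c)%N.
Proof.
move=> force leU; pose S : finType := {x | x \in U}.
have cS : #|S| = #|U| by rewrite card_sig; apply: eq_card => x; rewrite inE.
have [|I [cI dI]] := force S (fun x => f (val x)); first by rewrite cS.
exists (val @: I); first by apply/subsetP => _ /imsetP[x _ ->]; apply: valP.
rewrite card_imset //; last exact: val_inj.
split=> // c; rewrite big_imset //=; exact: (in2W val_inj).
Qed.

Lemma egz_leq m n s : (0 < m)%N -> zero_sum_forcing m n s -> (egz m n <= s)%N.
Proof.
move=> m_gt0 force; rewrite /egz; case: ex_minnP => e _; apply.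
apply/forallP => u.
have [|I [cI dI]] := force 'I_s (fun i c => val (tnth u i 0 c));
  first by rewrite card_ord.
have size_t : size [seq tnth u i | i <- enum I] == m by rewrite size_map -cardE
  cI.
apply/existsP; exists (Tuple size_t); apply/andP; split.
  rewrite /= -[X in subseq _ X](map_tnth_enum u); apply: map_subseq.
  by rewrite !enumT; exact: filter_subseq.
rewrite /= big_map big_enum /=; apply/eqP/rowP => c; rewrite summxE mxE.
case: m m_gt0 u force {cI size_t} dI => // m _ u _ dI.
have inZpD : {morph @inZp m : x y / (x + y)%N >-> x + y}.
  by move=> x y; apply: val_inj; rewrite /= modnDm.
rewrite (eq_bigr (fun i => inZp (val (tnth u i 0 c)))) => [|i _];
  last by rewrite valZpK.
rewrite -(big_morph _ inZpD (_ : inZp 0 = 0)); last exact: val_inj.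
apply: val_inj => /=; apply/eqP; exact: dI.
Qed.

Lemma zero_sum_forcing1 n : zero_sum_forcing 1 n 1.
Proof.
by move=> T f /card_gt0P[x _]; exists [set x]; rewrite cards1.
Qed.

(** Extract [sb] disjoint a-sets with sums divisible by [a], then apply the forcing for [b] to these
    sums divided by [a]. *)
Lemma zero_sum_forcingM a b n sa sb :
  (0 < a)%N -> zero_sum_forcing a n sa -> zero_sum_forcing b n sb ->
  zero_sum_forcing (a * b) n (sb * a + sa).
Proof.
move=> a_gt0 forcea forceb T f leT.
have ext t (U : {set T}) : (t * a + sa <= #|U|)%N -> exists C : nat -> {set T},
    (forall i, (i < t)%N -> [/\ C i \subset U, #|C i| = a &
       forall c, (a %| \sum_(x in C i) f x c)%N]) /\
    (forall i j, (i < j < t)%N -> [disjoint C i & C j]).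
  elim: t U => [|t IHt] U leU; first by exists (fun=> set0); split=> // i j;
    lia.
  have [|I sIU [cI dI]] := zero_sum_forcing_sub (U := U) f forcea.
    by apply: leq_trans leU; rewrite leq_addl.
  have [|C [CP dC]] := IHt (U :\: I).
    rewrite cardsD (setIidPr sIU) cI; move: leU; rewrite mulSn; clear; lia.
  exists (fun i => if i == t then I else C i); split=> [i|i j].
    rewrite ltnS leq_eqVlt; case: eqP => [_ _ //|_ /= /CP[sC cC dvC]].
    by split=> //; apply: subset_trans sC (subsetDl _ _).
  move=> /andP[ltij]; rewrite ltnS => lejt;
    rewrite (ltn_eqF (leq_trans ltij lejt)).
  have [_|nejt] := eqVneq j t; last by apply: dC; lia.
  have [sC _ _] := CP i (leq_trans ltij lejt).
  by move: sC; rewrite subsetD => /andP[].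
have [|C [CP dC]] := ext sb [set: T]; first by rewrite cardsT.
have dC' (i j : 'I_sb) : i != j -> [disjoint C i & C j].
  move=> nij; have [ltij|ltji|/val_inj eij] := ltngtP i j.
  - by apply: dC; rewrite ltij /=.
  - by rewrite disjoint_sym; apply: dC; rewrite ltji /=.
  - by rewrite eij eqxx in nij.
have [|J [cJ dJ]] := forceb 'I_sb (fun j c => (\sum_(x in C j) f x c) %/ a)%N.
  by rewrite card_ord.
have part (F : T -> nat) : (\sum_(x in \bigcup_(j in J) C j) F x =
    \sum_(j in J) \sum_(x in C j) F x)%N.
  pose F' (j : 'I_sb) := if j \in J then C j else set0.
  have -> : \bigcup_(j in J) C j = \bigcup_j F' j by rewrite [LHS]big_mkcond.
  rewrite partition_disjoint_bigcup => [|i j nij].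
    rewrite [RHS]big_mkcond; apply: eq_bigr => j _; rewrite /F'.
    by case: ifP => // _; rewrite big_set0.
  rewrite /F'; case: ifP => _; case: ifP => _;
    rewrite -setI_eq0 ?set0I ?setI0 //.
  by rewrite setI_eq0 dC'.
exists (\bigcup_(j in J) C j); split.
  rewrite -sum1_card (part (fun=> 1%N)) (eq_bigr (fun=> a)); last first.
    by move=> j _; rewrite sum1_card; case: (CP j (ltn_ord j)).
  by rewrite sum_nat_const cJ mulnC.
move=> c; rewrite (part (fun x => f x c)).
rewrite (eq_bigr (fun j : 'I_sb => a * ((\sum_(x in C j) f x c) %/ a))%N) =>
  [|j _].
  by rewrite -big_distrr /= dvdn_pmul2l.
by case: (CP j (ltn_ord j)) => _ _ dv; rewrite mulnC divnK.
Qed.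

(** * The bound *)

(** Either p of the vectors coincide and sum to zero, or each occurs fewer than p times and at least
    t are distinct. *)
Lemma zero_sum_forcing_prime (p n t : nat) : prime p ->
  (forall A : {set 'rV['F_p]_n}, (t <= #|A|)%N ->
    exists X : {set 'rV['F_p]_n}, [/\ X \subset A, #|X| = p & setsum X = 0]) ->
  zero_sum_forcing p n (p * t).
Proof.
move=> p_pr distinct T f leT; have p_gt0 := prime_gt0 p_pr.
pose v (x : T) : 'rV['F_p]_n := \row_c (f x c)%:R.
have dvE (I : {set T}) : \sum_(x in I) v x = 0 ->
  forall c, (p %| \sum_(x in I) f x c)%N.
  move=> e c; rewrite (dvdn_pcharf (pchar_Fp p_pr)) natr_sum; apply/eqP.
  have := congr1 (fun A : 'rV_n => A 0 c) e; rewrite !mxE summxE => e0.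
  by rewrite -[RHS]e0; apply: eq_bigr => x _; rewrite mxE.
have [/existsP[a lea]|] := boolP [exists a, (p <= #|[set x | v x == a]|)%N].
  have /card_gt0P[I] : (0 < #|[set I : {set T} | I \subset [set x | v x == a] &
    #|I| == p]|)%N.
    by rewrite cards_draws bin_gt0.
  rewrite inE => /andP[/subsetP sI /eqP cI]; exists I; split=> //; apply: dvE.
  rewrite (eq_bigr (fun=> a)) => [|x /sI]; last by rewrite inE => /eqP.
  rewrite sumr_const cI; apply/rowP => c.
  by rewrite mulmxnE mxE -mulr_natr (pchar_Fp_0 p_pr) mulr0.
rewrite negb_exists => /forallP small.
pose A := v @: [set: T].
have [|X [sX cX eX]] := distinct A.
  rewrite -(leq_pmul2l p_gt0); apply: leq_trans leT _; rewrite mulnC.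
  have cover : [set: T] \subset \bigcup_(a in A) [set x | v x == a].
    by apply/subsetP => x _; apply/bigcupP; exists (v x); rewrite ?imset_f ?inE.
  rewrite -cardsT; apply: leq_trans (subset_leq_card cover) _.
  apply: leq_card_bigcup_const => a _; apply: ltnW.
  by have := small a; rewrite -ltnNge.
have /choice[g gP] : forall a, exists x, a \in A -> v x = a.
  move=> a; have [/imsetP[x _ ->]|_] := boolP (a \in A); first by exists x.
  have /card_gt0P[x _] : (0 < #|T|)%N.
    have /card_gt0P[b bX] : (0 < #|X|)%N by rewrite cX.
    have /imsetP[x _ _] := subsetP sX b bX.
    by apply/card_gt0P; exists x.
  by exists x.
have g_inj : {in X &, injective g}.
  by move=> a b /(subsetP sX)/gP e1 /(subsetP sX)/gP e2 e; rewrite -e1 -e2 e.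
exists (g @: X); split; first by rewrite card_in_imset.
apply: dvE; rewrite big_imset //= -[RHS]eX; apply: eq_bigr => a aX.
exact: gP (subsetP sX a aX).
Qed.

(** No set has p^n + 1 vectors. This serves small primes and small dimensions. *)
Lemma zero_sum_forcing_trivial (p n : nat) : prime p ->
  zero_sum_forcing p n (p * (p ^ n).+1).
Proof.
move=> p_pr; apply: zero_sum_forcing_prime => // A leA; exfalso.
have := leq_trans leA (max_card _).
by rewrite card_mx card_Fp // mul1n ltnn.
Qed.

(** b + 1 is the e-th root of p rounded up. *)
Lemma base_exists (p e : nat) : (1 < p)%N -> (0 < e)%N ->
  exists b, [/\ (0 < b)%N, (b ^ e < p)%N & (p <= b.+1 ^ e)%N].
Proof.
move=> p_gt1 e_gt0.
have ex : exists b, (p <= b ^ e)%N.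
  by exists p; rewrite -[leqLHS]expn1 leq_exp2l.
case: (ex_minnP ex) => b leb minb.
have b_gt1 : (1 < b)%N.
  rewrite ltnNge; apply: contraTN p_gt1 => leb1; rewrite -leqNgt.
  by apply: leq_trans leb _; rewrite -(exp1n e) leq_exp2r.
exists b.-1; rewrite prednK ?(ltnW b_gt1) //; split=> //;
  first by rewrite -subn1 subn_gt0.
rewrite ltnNge; apply/negP => /minb; lia.
Qed.

(** * Choice of the constants *)

Section Bound.
Variable (R : realType).

(** With b < p^(1/W^2) <= b + 1, sets of size (b + 1)^(n (6W + 13)) suffice for large n, and 6W + 13
    <= 19W gives b^(6W + 13) <= p^(19/W) <= p^eps. *)
Lemma prime_bound (eps : R) : 0 < eps ->
  exists C : R, 1 <= C /\ forall p : nat, prime p ->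
  exists D : R, 0 <= D /\ forall n : nat, (0 < n)%N ->
  exists s, zero_sum_forcing p n s /\ s%:R <= D * (C * p%:R `^ eps) ^+ n.
Proof.
move=> eps_gt0.
pose W := (Num.truncn (19 / eps)).+1.
have W_gt0 : (0 < W)%N by [].
have leW : 19 / W%:R <= eps.
  rewrite ler_pdivrMr ?ltr0n // mulrC -ler_pdivrMr //.
  exact: ltW (truncnS_gt _).
clearbody W; pose e := (W * W)%N;
  have e_gt0 : (0 < e)%N by rewrite muln_gt0 W_gt0.
pose B0 := (min_base W ^ e)%N.
(* 2^(19W) pays for b + 1 <= 2b, and [B0] bounds the primes for which b + 1 is below
   [min_base W]. *)
pose C : R := (2 ^ (19 * W) + B0)%:R.
have C_ge1 : 1 <= C by rewrite ler1n addn_gt0 expn_gt0.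
have C_ge0 : 0 <= C by rewrite ler0n.
exists C; split=> // p p_pr; have p_gt1 := prime_gt1 p_pr.
have p_gt0 := prime_gt0 p_pr.
have p1 : (1 : R) <= p%:R by rewrite ler1n.
have pe1 : 1 <= p%:R `^ eps by rewrite -[leLHS](powRr0 p%:R);
  apply: ler_powR => //; apply: ltW.
have triv n : exists s, zero_sum_forcing p n s /\ (s <= 2 * p * p ^ n)%N.
  exists (p * (p ^ n).+1)%N; split; first exact: zero_sum_forcing_trivial.
  have : (0 < p ^ n)%N by rewrite expn_gt0 p_gt0.
  by rewrite -mulnA mulnCA leq_pmul2l //; lia.
have [b [b_gt0 ltb leb]] := base_exists p_gt1 e_gt0.
have [small|large] := ltnP b.+1 (min_base W).
  have lepB : (p <= B0)%N by apply: leq_trans leb _; rewrite leq_exp2r // ltnW.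
  exists (2 * p)%:R; rewrite ler0n; split=> // n n_gt0.
  have [s [fs les]] := triv n; exists s; split=> //.
  apply: le_trans (_ : (2 * p * p ^ n)%:R <= _); first by rewrite ler_nat.
  rewrite natrM natrX; apply: ler_wpM2l; first by rewrite ler0n.
  rewrite lerXn2r ?nnegrE ?mulr_ge0 ?powR_ge0 ?ler0n //.
  rewrite -[leLHS]mulr1 ler_pM ?ler0n // ler_nat.
  by apply: leq_trans lepB _; rewrite leq_addl.
have [n0 dist] := exists_distinct_zero_sum W_gt0 p_pr large leb.
have base : (b.+1 ^ (6 * W + 13))%:R <= C * p%:R `^ eps.
  apply: le_trans (_ : ((2 * b) ^ (19 * W))%:R <= _).
    rewrite ler_nat; apply: leq_trans (_ : (2 * b) ^ (6 * W + 13) <= _)%N.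
      by rewrite leq_exp2r ?addnS //; lia.
    by rewrite leq_pexp2l ?muln_gt0 //; lia.
  rewrite expnMn natrM; apply: ler_pM; rewrite ?ler0n //.
    by rewrite ler_nat leq_addr.
  apply: le_trans (ler_powR p1 leW).
  have -> : (b ^ (19 * W))%:R = ((b ^ e)%:R : R) `^ (19 / W%:R).
    rewrite !natrX -!powR_mulrn ?ler0n // -powRrM; congr (_ `^ _).
    have W0 : W%:R != 0 :> R by rewrite pnatr_eq0 -lt0n.
    by rewrite /e !natrM; move: (W%:R) W0 => w w0; field.
  apply: ge0_ler_powR; rewrite ?nnegrE ?ler0n ?divr_ge0 ?ler0n //.
  by rewrite ler_nat ltnW.
(* The first term serves n < n0 by the trivial bound; the second is the factor p of
   [zero_sum_forcing_prime]. *)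
exists (2 * p * p ^ n0 + p)%:R; rewrite ler0n; split=> // n n_gt0.
have X1 : 1 <= (C * p%:R `^ eps) ^+ n.
  by apply: exprn_ege1; rewrite -[leLHS]mulr1 ler_pM.
have [ltn|len] := ltnP n n0.
  have [s [fs les]] := triv n; exists s; split=> //.
  rewrite -[leLHS]mulr1 ler_pM ?ler0n // ler_nat; apply: leq_trans les _.
  apply: leq_trans (leq_addr _ _); rewrite leq_mul2l leq_pexp2l ?orbT //.
  exact: ltnW.
exists (p * (b.+1 ^ n) ^ (6 * W + 13))%N; split.
  apply: zero_sum_forcing_prime => // A; exact: dist.
rewrite natrM; apply: ler_pM; rewrite ?ler0n //.
  by rewrite ler_nat leq_addl.
rewrite -expnM mulnC expnM natrX lerXn2r ?nnegrE ?ler0n //.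
by rewrite mulr_ge0 // powR_ge0.
Qed.

End Bound.

Theorem theorem1p1 (R : realType) (eps : R) (eps_gt0 : 0 < eps) :
  exists C : R, forall m : nat, (2 <= m)%N ->
  exists D : R, forall n : nat, (0 < n)%N ->
    (egz m n)%:R <= D * (C * m%:R `^ eps) ^+ n.
Proof.
have [C [C1 primeC]] := prime_bound eps_gt0.
have C0 : 0 <= C by apply: le_trans C1.
exists C => m m_gt1; have m_gt0 := ltnW m_gt1.
pose X := C * m%:R `^ eps.
have me1 : 1 <= m%:R `^ eps by rewrite -[leLHS](powRr0 m%:R); apply: ler_powR;
  rewrite ?ler1n // ltW.
have X1 : 1 <= X by rewrite -[leLHS]mulr1 ler_pM.
have X0 : 0 <= X by apply: le_trans X1.
(* Split off one prime p of d at a time: since p^eps <= m^eps, the base X stays the same and only D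
   grows. *)
have bound d : (0 < d)%N -> (d %| m)%N -> exists D : R, 0 <= D /\
    forall n, (0 < n)%N -> exists s,
      zero_sum_forcing d n s /\ s%:R <= D * X ^+ n.
  have [k] := ubnP d; elim: k => // k IHk in d * => ltdk d_gt0 dvd.
  have [d1|d_gt1] := leqP d 1.
    have -> : d = 1%N by apply/eqP; rewrite eqn_leq d1.
    exists 1; split=> // n n_gt0; exists 1%N; split;
      first exact: zero_sum_forcing1.
    by rewrite mul1r exprn_ege1.
  have p_pr := pdiv_prime d_gt1; set p := pdiv d in p_pr.
  have dE : d = (p * (d %/ p))%N by rewrite mulnC divnK ?pdiv_dvd.
  have p_gt1 := prime_gt1 p_pr.
  have q_gt0 : (0 < d %/ p)%N by rewrite divn_gt0 ?prime_gt0 // dvdn_leq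
    ?pdiv_dvd.
  have [||D2 [D2_ge0 bound2]] := IHk (d %/ p)%N _ q_gt0.
  - by rewrite -ltnS; apply: leq_trans ltdk; rewrite ltnS ltn_Pdiv.
  - by apply: dvdn_trans dvd; rewrite [X in (_ %| X)%N]dE dvdn_mull.
  have [D1 [D1_ge0 bound1]] := primeC p p_pr.
  exists (D2 * p%:R + D1); split; first by rewrite addr_ge0 // mulr_ge0 ?ler0n.
  move=> n n_gt0; have [s1 [f1 le1]] := bound1 n n_gt0.
  have [s2 [f2 le2]] := bound2 n n_gt0.
  exists (s2 * p + s1)%N; split.
    by rewrite dE; apply: zero_sum_forcingM => //; apply: prime_gt0.
  rewrite natrD natrM mulrDl; apply: lerD.
    by rewrite mulrAC ler_wpM2r ?ler0n.
  apply: le_trans le1 _; apply: ler_wpM2l => //.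
  rewrite lerXn2r ?nnegrE ?mulr_ge0 ?powR_ge0 //.
  apply: ler_wpM2l => //; rewrite ge0_ler_powR ?nnegrE ?ler0n ?(ltW eps_gt0) //.
  by rewrite ler_nat dvdn_leq // (dvdn_trans _ dvd) // pdiv_dvd.
have [D [_ boundm]] := bound m m_gt0 (dvdnn m).
exists D => n n_gt0; have [s [fs les]] := boundm n n_gt0.
by apply: le_trans les; rewrite ler_nat egz_leq.
Qed.
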